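(* Let $d\ge 1$ be an integer and let $\gamma,\delta,c_\phi,c_f>0$. There exist a constant $G>0$ depending only on $d,\gamma,\delta,c_\phi,c_f$ and a constant $\bar G>0$ depending only on $d,\gamma,c_\phi$ such that the following holds. Let $X_1,X_2$ be $\mathbb{R}^d$-valued random variables with characteristic functions $\phi_1,\phi_2$, and assume that $$|\phi_i(u)|\le c_\phi(1+|u|)^{-d-\gamma}\quad\text{for all }u\in\mathbb{R}^d,\ i=1,2,$$ and $$E[|X_i|^\delta]\le c_f,\quad i=1,2.$$ Then $$d_{TV}(X_1,X_2)\le G\, d_{FM}(X_1,X_2)^{g},\qquad g=\frac{\gamma\delta}{(d+1+\gamma)(d+\delta)}.$$ Moreover, $X_1,X_2$ have respective density functions $f_1,f_2$ (with respect to Lebesgue measure on $\mathbb{R}^d$) and $$\sup_{x\in\mathbb{R}^d}|f_1(x)-f_2(x)|\le \bar G\, d_{FM}(X_1,X_2)^{\bar g},\qquad \bar g=\frac{\gamma}{d+1+\gamma}.$$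
   Context: $|\cdot|$ is the Euclidean norm, $\langle\cdot,\cdot\rangle$ the scalar product, and the characteristic function of an $\mathbb{R}^d$-valued random variable $X$ is $\phi_X(u)=E[e^{i\langle u,X\rangle}]$, $u\in\mathbb{R}^d$. For a function $f$ on $\mathbb{R}^d$, $\|f\|_\infty=\sup_{x}|f(x)|$. Let $\mathcal{M}_1$ be the set of continuously differentiable $f:\mathbb{R}^d\to\mathbb{R}$ with $\|f\|_\infty+\|\nabla f\|_\infty\le 1$. For Borel probability measures $\mu_1,\mu_2$ on $\mathbb{R}^d$, the Fortet--Mourier distance is $d_{FM}(\mu_1,\mu_2)=\sup_{f\in\mathcal{M}_1}|\int f\,d\mu_1-\int f\,d\mu_2|$, and the total variation distance is $d_{TV}(\mu_1,\mu_2)=\sup_{|f|\le 1}|\int f\,d\mu_1-\int f\,d\mu_2|$, the supremum being over measurable $f:\mathbb{R}^d\to\mathbb{R}$ with $|f|\le 1$. For random variables, $d_{FM}(X_1,X_2)$ and $d_{TV}(X_1,X_2)$ denote the distances between their laws. The densities $f_1,f_2$ in the supremum bound are the continuous ones. *)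

(* Defs.v *)
From HB Require Import structures.
From mathcomp Require Import all_boot all_order all_algebra.
From mathcomp Require Import all_classical all_reals all_analysis.
From mathcomp Require Import measurable_realfun.
From mathcomp Require Import complex.

Set Implicit Arguments.
Unset Strict Implicit.
Unset Printing Implicit Defensive.

Import Order.TTheory GRing.Theory Num.Theory.
Import numFieldNormedType.Exports.

Local Open Scope classical_set_scope.
Local Open Scope ring_scope.

Section rV_borel.
Variables (R : realType) (d : nat).

(* 'rV[R]_d carries its Borel sigma-algebra, generated by the open sets *)
HB.instance Definition _ := @isMeasurable.Build default_measure_display
  'rV[R]_d <<s @open 'rV[R]_d >> (@sigma_algebra0 _ setT open)
  (@sigma_algebraC _ open) (@sigma_algebra_bigcup _ setT open).

Lemma open_measurable_rV (A : set 'rV[R]_d) : open A -> measurable A.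
Proof. exact: sub_sigma_algebra. Qed.

Lemma measurable_coord (i : 'I_1) (j : 'I_d) :
  measurable_fun [set: 'rV[R]_d] (fun v : 'rV[R]_d => v i j).
Proof.
apply: (measurability _ (RGenOpens.measurableE R)).
move=> _ [_ [a [b ->] <-]]; rewrite setTI; apply: open_measurable_rV.
apply: open_comp; last exact: interval_open.
by move=> v _; exact: coord_continuous.
Qed.

End rV_borel.

Section rV_measurable_fun.
Context {dT} {T : measurableType dT} {R : realType} {d : nat}.

Lemma measurable_fun_rV (f : T -> 'rV[R]_d) :
  (forall j, measurable_fun setT (fun t => f t ord0 j)) ->
  measurable_fun setT f.
Proof.
move=> mf; apply: (@measurability _ _ T 'rV[R]_d setT f (@open _)) => //.
move=> _ [U oU <-]; rewrite setTI.
pose q (r : 'rV[rat]_d * nat) : 'rV[R]_d := map_mx ratr r.1.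
pose B (r : 'rV[rat]_d * nat) : set 'rV[R]_d := ball (q r) r.2.+1%:R^-1.
pose C r : set T := if `[< B r `<=` U >] then f @^-1` B r else set0.
have -> : f @^-1` U = \bigcup_(r in setT) C r.
  apply/seteqP; split=> [t Ut|t [r _]]; last first.
    by rewrite /C; case: asboolP => // BU Bt; exact: BU.
  have /nbhs_ballP[e /= e0 eU] : nbhs (f t) U by exact: open_nbhs_nbhs.
  have [n ne] : exists n : nat, n.+1%:R^-1 < e / 2.
    have e20 : 0 < e / 2 by rewrite divr_gt0.
    have [n _ Pn] := near_infty_natSinv_lt (PosNum e20).
    by exists n; exact: (Pn n (leqnn n)).
  have n0 : 0 < n.+1%:R^-1 :> R by rewrite invr_gt0.
  have ex j : exists p : rat, ball (f t ord0 j) n.+1%:R^-1 (ratr p : R).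
    have [||x [xb [p _ px]]] := @dense_rat R (ball (f t ord0 j) n.+1%:R^-1).
    - by exists (f t ord0 j); exact: ballxx.
    - exact: ball_open.
    by exists p; rewrite px.
  have [p pP] := choice ex.
  have tB : B (\row_j p j, n) (f t).
    split => // i j; rewrite ord1 !mxE /=; exact/ball_sym/pP.
  exists (\row_j p j, n) => //; rewrite /C asboolT// => v Bv.
  apply: eU; apply: (@le_ball _ _ _ (n.+1%:R^-1 + n.+1%:R^-1)).
    by rewrite [leRHS](splitr e) lerD// ltW.
  exact: (ball_triangle (ball_sym tB) Bv).
apply: countable_bigcupT_measurable => [|r]; first exact: countableP.
rewrite /C; case: asboolP => // _.
have -> : f @^-1` B r = \big[setI/setT]_(j < d)
    ((fun t => f t ord0 j) @^-1` ball (q r ord0 j) r.2.+1%:R^-1).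
  rewrite -bigcap_seq; apply/seteqP; split => [t [_ h] j _|t h].
    exact: h.
  split => [|i j]; first by rewrite invr_gt0.
  by rewrite ord1; apply: h => /=; rewrite mem_index_enum.
apply: bigsetI_measurable => j _; rewrite -[X in measurable X]setTI.
by apply: mf => //; exact: measurable_ball.
Qed.

End rV_measurable_fun.

Section lebesgue_measure_rV.
Variable R : realType.

Definition rV_cons n (p : measurableTypeR R * 'rV[R]_n) : 'rV[R]_n.+1 :=
  \row_i oapp (p.2 ord0) p.1 (unlift ord0 i).

Definition rV_uncons n (v : 'rV[R]_n.+1) : measurableTypeR R * 'rV[R]_n :=
  (v ord0 ord0, \row_i v ord0 (lift ord0 i)).

Lemma rV_consK n : cancel (@rV_cons n) (@rV_uncons n).
Proof.
case=> x v; rewrite /rV_uncons /rV_cons; congr pair.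
  by rewrite mxE unlift_none.
by apply/rowP => i; rewrite !mxE liftK.
Qed.

Lemma rV_unconsK n : cancel (@rV_uncons n) (@rV_cons n).
Proof.
move=> v; apply/rowP => i; rewrite !mxE.
by case: unliftP => [j|] -> //=; rewrite mxE.
Qed.

Lemma measurable_rV_cons n : measurable_fun setT (@rV_cons n).
Proof.
apply: measurable_fun_rV => j.
under eq_fun do rewrite mxE.
case: unliftP => [k|] _ /=; last exact: measurable_fst.
exact: (measurableT_comp (measurable_coord ord0 k) measurable_snd).
Qed.

Lemma measurable_rV_uncons n : measurable_fun setT (@rV_uncons n).
Proof.
apply/measurable_fun_pairP; split; first exact: measurable_coord.
apply: measurable_fun_rV => j.
under eq_fun do rewrite mxE.
exact: measurable_coord.
Qed.

Section step.
Variables (n : nat) (m : {sigma_finite_measure set 'rV[R]_n -> \bar R}).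

Definition lebesgue_rV_step : set 'rV[R]_n.+1 -> \bar R :=
  pushforward (@lebesgue_measure R \x m)%E (@rV_cons n).

Let step0 : lebesgue_rV_step set0 = 0%E.
Proof. by rewrite /lebesgue_rV_step /pushforward preimage_set0 measure0. Qed.

Let step_ge0 A : (0 <= lebesgue_rV_step A)%E.
Proof. by rewrite /lebesgue_rV_step /pushforward measure_ge0. Qed.

Let step_sigma_additive : semi_sigma_additive lebesgue_rV_step.
Proof.
have mcons A : measurable A -> measurable (@rV_cons n @^-1` A).
  by move=> mA; rewrite -[X in measurable X]setTI; exact: measurable_rV_cons.
move=> F mF tF mUF; rewrite /lebesgue_rV_step /pushforward preimage_bigcup.
apply: measure_semi_sigma_additive => [k||]; first exact: mcons.
- apply/trivIsetP => /= i j _ _ ij; rewrite -preimage_setI.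
  by move/trivIsetP : tF => /(_ _ _ _ _ ij) ->//; rewrite preimage_set0.
- by rewrite -preimage_bigcup; exact: mcons.
Qed.

HB.instance Definition _ := isMeasure.Build _ _ _ lebesgue_rV_step
  step0 step_ge0 step_sigma_additive.

Let step_sigma_finite : sigma_finite setT lebesgue_rV_step.
Proof.
have /sigma_finiteP[F [TF ndF Foo]] := sigma_finiteT (@lebesgue_measure R).
have /sigma_finiteP[G [TG ndG Goo]] := sigma_finiteT m.
exists (fun k => @rV_uncons n @^-1` (F k `*` G k)).
  apply/seteqP; split => // v _.
  have [k _ Fk] : (\bigcup_k F k) (v ord0 ord0) by rewrite -TF.
  have [l _ Gl] : (\bigcup_k G k) (rV_uncons v).2 by rewrite -TG.
  exists (maxn k l) => //; split.
  - by move: Fk; exact/subsetPset/ndF/leq_maxl.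
  - by move: Gl; exact/subsetPset/ndG/leq_maxr.
move=> k; have [mF Fk] := Foo k; have [mG Gk] := Goo k; split.
  rewrite -[X in measurable X]setTI.
  by apply: measurable_rV_uncons => //; exact: measurableX.
rewrite /lebesgue_rV_step /pushforward -comp_preimage.
rewrite (_ : _ \o _ = id) ?preimage_id; last exact/funext/rV_consK.
by rewrite product_measure1E// lte_mul_pinfty// ge0_fin_numE.
Qed.

HB.instance Definition _ := Measure_isSigmaFinite.Build _ _ _ lebesgue_rV_step
  step_sigma_finite.

End step.

(* d-fold product of the Lebesgue measure of R, transported to row vectors;
   lebesgue_rV_box gives its value on boxes *)
Fixpoint lebesgue_rV n : {sigma_finite_measure set 'rV[R]_n -> \bar R} :=
  match n with
  | 0 => \d_(0 : 'rV[R]_0)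
  | n'.+1 => lebesgue_rV_step (lebesgue_rV n')
  end.

Lemma measurable_rV_box n (a b : 'rV[R]_n) :
  measurable [set x : 'rV[R]_n | forall i, a ord0 i < x ord0 i <= b ord0 i].
Proof.
rewrite (_ : [set _ | _] = \big[setI/setT]_(j < n)
    ((fun x : 'rV[R]_n => x ord0 j) @^-1` `]a ord0 j, b ord0 j])).
  apply: bigsetI_measurable => j _; rewrite -[X in measurable X]setTI.
  exact: measurable_coord.
rewrite -bigcap_seq; apply/seteqP; split => [x h j _|x h i].
  by rewrite /= in_itv; exact: h.
by have := h i; rewrite /= in_itv; apply; rewrite mem_index_enum.
Qed.

Lemma lebesgue_rV_box n (a b : 'rV[R]_n) :
  (forall i, a ord0 i <= b ord0 i) ->
  lebesgue_rV n [set x | forall i, a ord0 i < x ord0 i <= b ord0 i]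
  = (\prod_(i < n) (b ord0 i - a ord0 i))%:E.
Proof.
elim: n a b => [|n IH] a b ab.
  by rewrite big_ord0 /= diracE mem_set// => -[].
rewrite /= /lebesgue_rV_step /pushforward.
pose a' : 'rV[R]_n := \row_i a ord0 (lift ord0 i).
pose b' : 'rV[R]_n := \row_i b ord0 (lift ord0 i).
rewrite (_ : _ @^-1` _ = `]a ord0 ord0, b ord0 ord0] `*`
    [set x : 'rV[R]_n | forall i, a' ord0 i < x ord0 i <= b' ord0 i])%classic.
  rewrite product_measure1E//=; last exact: measurable_rV_box.
  rewrite IH => [|i]; last by rewrite !mxE.
  rewrite lebesgue_measure_itv/= lte_fin big_ord_recl EFinM; congr (_ * _)%E.
    case: ltP => // ba; rewrite (_ : b ord0 ord0 = a ord0 ord0) ?subrr//.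
    by apply/le_anti; rewrite ba ab.
  by congr EFin; apply: eq_bigr => i _; rewrite !mxE.
apply/seteqP; split => -[x v] /= h.
- split; first by have := h ord0; rewrite mxE unlift_none /= in_itv.
  by move=> i; have := h (lift ord0 i); rewrite !mxE liftK.
- move=> i; rewrite mxE; case: unliftP => [j|] -> /=.
  + by have := h.2 j; rewrite !mxE.
  + by have := h.1; rewrite /= in_itv.
Qed.

End lebesgue_measure_rV.

Local Open Scope complex_scope.

Section euclidean.
Variables (R : realType) (d : nat).
Implicit Types u v : 'rV[R]_d.

Definition dot u v : R := \sum_(i < d) u ord0 i * v ord0 i.

(* the norm `|u| of mathcomp-analysis on 'rV[R]_d is the max norm *)
Definition enorm u : R := Num.sqrt (dot u u).

Definition grad (f : 'rV[R]_d -> R) (x : 'rV[R]_d) : 'rV[R]_d :=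
  \row_(i < d) 'D_(delta_mx ord0 i) f x.

Definition C1 (f : 'rV[R]_d -> R) : Prop :=
  (forall x, differentiable f x) /\ continuous (grad f).

Definition supnorm (g : 'rV[R]_d -> R) : \bar R :=
  ereal_sup (range (fun x => `|g x|%:E)).

Definition M1 : set ('rV[R]_d -> R) :=
  [set f | C1 f /\ (supnorm f + supnorm (enorm \o grad f) <= 1)%E].

End euclidean.

Section distances.
Variables (R : realType) (d : nat).
Local Open Scope ereal_scope.
Implicit Types mu : probability 'rV[R]_d R.

Definition dFM mu1 mu2 : \bar R :=
  ereal_sup [set `|\int[mu1]_x (f x)%:E - \int[mu2]_x (f x)%:E| | f in @M1 R d].

Definition dTV mu1 mu2 : \bar R :=
  ereal_sup [set `|\int[mu1]_x (f x)%:E - \int[mu2]_x (f x)%:E|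
            | f in [set f : 'rV[R]_d -> R |
                     measurable_fun setT f /\ forall x, (`|f x| <= 1)%R]].

Definition is_density mu (f : 'rV[R]_d -> R) : Prop :=
  [/\ measurable_fun setT f, forall x, (0 <= f x)%R &
      forall A, measurable A -> mu A = \int[lebesgue_rV R d]_(x in A) (f x)%:E].

End distances.

Section charfun.
Context {dT} {T : measurableType dT} {R : realType} {d : nat}.

Definition expi (t : R) : R[i] := cos t +i* sin t.

(* expectation of a complex random variable, componentwise; total: it is the
   mathematical one only when both components are integrable *)
Definition cexpectation (P : probability T R) (Z : T -> R[i]) : R[i] :=
  (\int[P]_w complex.Re (Z w)) +i* (\int[P]_w complex.Im (Z w)).

Definition charfun (P : probability T R) (X : {RV P >-> 'rV[R]_d})
    (u : 'rV[R]_d) : R[i] :=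
  cexpectation P (fun w => expi (dot u (X w))).

End charfun.
Arguments charfun {dT T R d} P X u.

(* Main.v *)
(** By Fourier inversion each law has the continuous density
    [f(x) = (2 pi)^-d \int psi(u, x) du], where [psi(u, x)] is the real part of
    [e^(i<u,x>)] times the conjugate of the characteristic function.  Inversion is
    proved with the damping factor [prod_i e^(-e |u_i|)], whose Fourier transform is
    a product of Cauchy kernels: all integrands factor over the coordinates, so
    Tonelli and one-variable antiderivatives suffice, and the mass of a box comes
    out as a product of differences of arctangents.

    Testing [d_FM] with [y |-> cos <u, x - y> / (1 + |u|)] bounds the difference of
    the two integrands by [(1 + |u|) d_FM]; the decay hypothesis bounds it by
    [2 c (1 + |u|)^(-d-gamma)].  Switching between the two at
    [|u| = (d_FM / 2)^(-1/(d+1+gamma))] gives the supremum bound.  Integrating that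
    bound over a box of half-width [M], adding Markov's inequality outside the box
    and optimising over [M] gives the total variation bound. *)

Require Import Defs.
From HB Require Import structures.
From mathcomp Require Import all_boot all_order all_algebra.
From mathcomp Require Import all_classical all_reals all_analysis.
From mathcomp Require Import measurable_realfun complex ring lra.

Set Implicit Arguments.
Unset Strict Implicit.
Unset Printing Implicit Defensive.

Import Order.TTheory GRing.Theory Num.Theory.
Import numFieldNormedType.Exports.

Local Open Scope classical_set_scope.
Local Open Scope ring_scope.
Local Open Scope complex_scope.

(** Polar coordinates are avoided throughout. With n the dimension and g the extra decay gamma,
    |u_i| <= |u| shows that (K + |u|)^(-n-g) is at most the product over i of (K + |u_i|)^(-1-g/n).
    The integral of this product over R^n is the n-th power of a one-variable tail integral, namely
    (2n/g)^n K^(-g). With K = 1 the product, times c, dominates the limits under the frequency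
    integral; with K the switching radius it yields the power of d_FM.

    The obstacle in the inversion is that the law might charge the faces of a box. The regularised
    densities are therefore evaluated at x + s_k, with a shift of order 1/k that is large against
    the kernel width 1/k^2. The Cauchy mass of a half-open box then tends to its indicator at every
    point, faces included, and no exceptional boxes arise.

    Signed integrands are made nonnegative by adding 1 where Tonelli or monotonicity is wanted: 1 +
    cos in the inversion formula, 1 + h for a test function h in the total variation bound. The
    added constant contributes equally to both sides and cancels. *)

(** * One-variable integrals: damped cosine, power tail, Cauchy kernel *)

Section one_dimensional_integrals.
Variable R : realType.
Implicit Types (e A B t x a b c K al th : R) (f : R -> R).
Local Notation leb := (@lebesgue_measure R).

(** A cosine with a phase is not even, so the two half-lines are kept as separate terms instead of
    one being doubled. *)
Lemma ge0_integralT_halves f : (forall t, 0 <= f t) -> continuous f ->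
  (\int[leb]_t (f t)%:E =
   \int[leb]_(t in `[0%R, +oo[) (f t)%:E + \int[leb]_(t in `[0%R, +oo[) (f (- t))%:E)%E.
Proof.
move=> f0 cf.
have mf : measurable_fun [set: R] f by exact: continuous_measurable_fun.
rewrite -(setUv `[0%R, +oo[) ge0_integral_setU//=; last 4 first.
  exact: measurableC.
  by apply/measurable_EFinP; rewrite setUv.
  by move=> x _; rewrite lee_fin.
  exact/disj_setPCl.
congr (_ + _)%E.
rewrite setCitvr.
rewrite integral_itv_bndo_bndc; last exact/measurable_EFinP/measurable_funTS.
rewrite -{1}oppr0 ge0_integration_by_substitutionNy//.
exact: continuous_subspaceT.
Qed.

Let is_derive_scale (c t : R) : is_derive t 1 (fun s : R => c * s) c.
Proof.
by apply: (is_derive_eq (is_deriveZ c (is_derive_id t 1))); rewrite /GRing.scale /= mulr1.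
Qed.

Let is_derive_affine (a c t : R) : is_derive t 1 (fun s : R => a + s * c) c.
Proof.
have -> : (fun s => a + s * c) = cst a + (fun s => c * s).
  by apply/funext => s /=; rewrite mulrC.
by apply: (is_derive_eq (is_deriveD (is_derive_cst a t 1) (is_derive_scale c t))); rewrite add0r.
Qed.

Let cont_of_derive f (df : R -> R) : (forall t, is_derive t (1 : R) f (df t)) -> continuous f.
Proof. by move=> h t; apply/differentiable_continuous/derivable1_diffP; case: (h t). Qed.

Lemma cvg_expRN_bounded e C f : 0 < e -> (forall t, `|f t| <= C) ->
  expR (- (e * t)) * f t @[t --> +oo] --> (0 : R).
Proof.
move=> e0 fC.
have h : expR (- (e * t)) @[t --> +oo] --> (0 : R).
  apply: (@cvg_comp _ _ _ (fun t => e * t) (fun z => expR (- z)) _ (pinfty_nbhs R));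
      last exact: cvgr_expR.
  exact: gt0_cvgMry.
apply: (@squeeze_cvgr _ _ _ _ (fun t => - (expR (- (e * t)) * C)) (fun t => expR (- (e * t)) * C)).
- near=> t; rewrite -ler_norml normrM ger0_norm ?expR_ge0//.
  by rewrite ler_wpM2l// expR_ge0.
- rewrite -oppr0 -(mul0r C); apply: cvgN; apply: cvgM => //; exact: cvg_cst.
- rewrite -(mul0r C); apply: cvgM => //; exact: cvg_cst.
Unshelve. all: by end_near.
Qed.

Lemma addcos_ge0 A B t : `|B| <= A -> 0 <= A + B * cos t.
Proof.
move=> BA; rewrite -lerBlDl sub0r; apply: (@le_trans _ _ (- `|B|)).
  by rewrite lerN2.
rewrite lerNl; apply: (le_trans (ler_norm _)).
by rewrite normrN normrM ler_piMr// ler_norml cos_geN1 cos_le1.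
Qed.

(** The condition [|B| <= A] makes the integrand nonnegative, so the fundamental theorem on a
    half-line applies as soon as the antiderivative has a limit at infinity. *)
Lemma integral_expR_cos_half e A B th x : 0 < e -> `|B| <= A ->
  (\int[leb]_(t in `[0%R, +oo[) (expR (- (e * t)) * (A + B * cos (th + t * x)))%:E
   = (A / e + B * (e * cos th - x * sin th) / (e ^+ 2 + x ^+ 2))%:E)%E.
Proof.
move=> e0 BA.
have q0 : e ^+ 2 + x ^+ 2 != 0 by rewrite gt_eqF// ltr_pwDl ?exprn_gt0// sqr_ge0.
have en0 : e != 0 by rewrite gt_eqF.
pose D := e ^+ 2 + x ^+ 2.
(* Up to the factor [B], the oscillating part of the antiderivative is the real part of exp((-e + i
   x) t + i th) / (-e + i x). *)
pose G t := - (A / e) + (B / D) * (x * sin (th + t * x) - e * cos (th + t * x)).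
pose F t := expR (- (e * t)) * G t.
have dE t : is_derive t (1:R) (fun s => expR (- (e * s))) (- e * expR (- (e * t))).
  have h1 : is_derive t 1 (fun s : R => - (e * s)) (- e).
    have -> : (fun s : R => - (e * s)) = (fun s => (- e) * s).
      by apply/funext => s; rewrite mulNr.
    exact: is_derive_scale.
  apply: (is_derive_eq (@is_derive1_comp _ expR (fun s => - (e * s)) t _ _ (is_derive_expR _) h1)).
  by rewrite mulrC.
have dS t : is_derive t (1:R) (fun s => sin (th + s * x)) (x * cos (th + t * x)).
  have h1 := is_derive_affine th x t.
  apply: (is_derive_eq (@is_derive1_comp _ sin (fun s => th + s * x) t _ _ (is_derive_sin _) h1)).
  by rewrite mulrC.
have dC t : is_derive t (1:R) (fun s => cos (th + s * x)) (- (x * sin (th + t * x))).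
  have h1 := is_derive_affine th x t.
  apply: (is_derive_eq (@is_derive1_comp _ cos (fun s => th + s * x) t _ _ (is_derive_cos _) h1)).
  by rewrite mulrC mulrN.
have dG t : is_derive t (1:R) G
    ((B / D) * (x * (x * cos (th + t * x)) + e * (x * sin (th + t * x)))).
  have -> : G = cst (- (A / e)) + (B / D) *:
      (x *: (fun s => sin (th + s * x)) - e *: (fun s => cos (th + s * x))).
    by apply/funext.
  apply: (is_derive_eq (is_deriveD (is_derive_cst _ t 1)
    (is_deriveZ (B / D) (is_deriveB (is_deriveZ x (dS t)) (is_deriveZ e (dC t)))))).
  by rewrite add0r /GRing.scale /= mulrN opprK.
have dF t : is_derive t (1:R) F (expR (- (e * t)) * (A + B * cos (th + t * x))).
  apply: (is_derive_eq (is_deriveM (dE t) (dG t))).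
  rewrite /GRing.scale /= /G /D.
  move: (expR _) (sin _) (cos _) q0 => E s c q0; field.
  by rewrite q0 en0.
have cF := cont_of_derive dF.
rewrite (@ge0_continuous_FTC2y _ _ F 0 0).
- rewrite sub0e -EFinN /F /G mulr0 oppr0 expR0 mul1r mul0r addr0; congr EFin.
  by rewrite /D; move: (sin _) (cos _) q0 => s c q0; field; rewrite q0 en0.
- by move=> t _; rewrite mulr_ge0 ?expR_ge0 ?addcos_ge0.
- apply: continuous_subspaceT => t; apply: cvgM; first exact: (cont_of_derive dE).
  apply: cvgD; first exact: cvg_cst.
  by apply: cvgM; [exact: cvg_cst|exact: (cont_of_derive dC)].
- apply: (@cvg_expRN_bounded _ (`|A / e| + `|B / D| * (`|x| + e))) => // t.
  apply: (le_trans (ler_normD _ _)); rewrite normrN lerD2l normrM ler_wpM2l//.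
  apply: (le_trans (ler_normB _ _)); rewrite !normrM (gtr0_norm e0).
  apply: lerD; apply: ler_piMr; rewrite ?normr_ge0 ?(ltW e0)//.
    by rewrite ler_norml sin_geN1 sin_le1.
  by rewrite ler_norml cos_geN1 cos_le1.
- by move=> t _; case: (dF t).
- by apply: cvg_at_right_filter; exact: cF.
- by move=> t _; rewrite derive1E; case: (dF t).
Qed.

(** Reflecting t negates the frequency [x], so the [sin th] terms of the two half-lines cancel. *)
Lemma integral_expR_cos e A B th x : 0 < e -> `|B| <= A ->
  (\int[leb]_t (expR (- (e * `|t|)) * (A + B * cos (th + t * x)))%:E
   = (A * (2 / e) + B * cos th * (2 * e / (e ^+ 2 + x ^+ 2)))%:E)%E.
Proof.
move=> e0 BA.
rewrite ge0_integralT_halves; first last.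
- move=> t; apply: cvgM.
    apply: (@continuous_comp _ _ _ (fun s : R => - (e * `|s|)) expR); last exact: continuous_expR.
    by apply: cvgN; apply: cvgM; [exact: cvg_cst|exact: norm_continuous].
  apply: cvgD; first exact: cvg_cst.
  apply: cvgM; first exact: cvg_cst.
  apply: (@continuous_comp _ _ _ (fun s : R => th + s * x) cos); last exact: continuous_cos.
  exact: (cont_of_derive (is_derive_affine th x)).
- by move=> t; rewrite mulr_ge0 ?expR_ge0 ?addcos_ge0.
under eq_integral => t.
  rewrite inE/= in_itv/= andbT => t0; rewrite ger0_norm//; over.
under [X in (_ + X)%E]eq_integral => t.
  rewrite inE/= in_itv/= andbT => t0; rewrite normrN ger0_norm// mulNr -mulrN; over.
have q0 : e ^+ 2 + x ^+ 2 != 0 by rewrite gt_eqF// ltr_pwDl ?exprn_gt0// sqr_ge0.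
rewrite !integral_expR_cos_half// -EFinD sqrrN; congr EFin; field.
by rewrite q0 gt_eqF.
Qed.

Lemma integral_powR_tail K al : 0 < K -> 0 < al ->
  (\int[leb]_t ((K + `|t|) `^ (- al - 1))%:E = (2 * K `^ (- al) / al)%:E)%E.
Proof.
move=> K0 al0.
have pos t : 0 <= t -> 0 < K + t by move=> t0; rewrite ltr_wpDr.
have aln0 : al != 0 by rewrite gt_eqF.
have powE c t : 0 < t -> t `^ c = expR (c * ln t) by move=> t0; rewrite /powR gt_eqF.
rewrite ge0_symfun_integralT; last 3 first.
- by move=> t; rewrite powR_ge0.
- have -> : (fun t => (K + `|t|) `^ (- al - 1)) = expR \o (fun t : R => (- al - 1) * ln (K + `|t|)).
    by apply/funext => t /=; rewrite powE// pos.
  move=> t; apply: continuous_comp; last exact: continuous_expR.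
  apply: cvgM; first exact: cvg_cst.
  apply: (@continuous_comp _ _ _ (fun t : R => K + `|t|) (@ln R)); last exact/continuous_ln/pos.
  by apply: cvgD; [exact: cvg_cst|exact: norm_continuous].
- by move=> t /=; rewrite normrN.
rewrite -set_itvcy.
under eq_integral => t.
  rewrite inE/= in_itv/= andbT => t0; rewrite ger0_norm//; over.
pose F t := (- al^-1) * (K + t) `^ (- al).
(* The range [- K < t] contains a neighbourhood of 0, so continuity of [F] at the endpoint 0 follows
   from the same fact. *)
have dF t : - K < t -> is_derive t (1:R) F ((K + t) `^ (- al - 1)).
  move=> t0; have p : 0 < K + t by rewrite -ltrBlDl sub0r.
  have h1 : is_derive t 1 (fun s : R => K + s) 1.
    have -> : (fun s : R => K + s) = (fun s => K + s * 1) by apply/funext => s; rewrite mulr1.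
    exact: is_derive_affine.
  have h2 := is_derive1_powR (- al) p.
  have h3 := @is_derive1_comp _ (fun y => y `^ (- al)) (fun s => K + s) t _ _ h2 h1.
  apply: (is_derive_eq (is_deriveZ (- al^-1) h3)).
  by rewrite /GRing.scale /=; field.
rewrite (@ge0_continuous_FTC2y _ _ F 0 0).
- by rewrite sub0e -EFinN -EFinM /F addr0; congr EFin; field.
- by move=> t _; rewrite powR_ge0.
- apply: continuous_in_subspaceT => t; rewrite inE/= in_itv/= andbT => t0.
  have p := pos _ t0.
  have h1 : {for t, continuous (fun s : R => K + s)}.
    by apply: cvgD; [exact: cvg_cst|exact: cvg_id].
  apply: (@continuous_comp _ _ _ (fun s : R => K + s) (fun y => y `^ (- al - 1))) => //.
  have h2 := is_derive1_powR (- al - 1) p.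
  by apply/differentiable_continuous/derivable1_diffP; case: h2.
- rewrite /F -(mulr0 (- al^-1)); apply: cvgM; first exact: cvg_cst.
  have h : expR (- (al * ln (K + t))) @[t --> +oo] --> (0 : R).
    apply: (@cvg_comp _ _ _ (fun t => al * ln (K + t)) (fun z => expR (- z)) _ (pinfty_nbhs R));
      last exact: cvgr_expR.
    apply: (@cvg_comp _ _ _ (fun t => ln (K + t)) (fun z => al * z) _ (pinfty_nbhs R));
      last exact: gt0_cvgMry.
    apply/cvgryPge => M; near=> t.
    have t0 : 0 <= t by near: t; apply: nbhs_pinfty_ge; exact: num_real.
    rewrite -ler_expR lnK; last by rewrite posrE pos.
    by rewrite -lerBlDl; near: t; apply: nbhs_pinfty_ge; exact: num_real.
  apply: cvg_trans h; apply: near_eq_cvg; near=> t.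
  have t0 : 0 <= t by near: t; apply: nbhs_pinfty_ge; exact: num_real.
  by rewrite powE ?pos// mulNr.
- by move=> t t0; have [] := dF t; first by apply: lt_trans t0; rewrite oppr_lt0.
- apply: cvg_at_right_filter.
  have [|dd _] := dF 0; first by rewrite oppr_lt0.
  exact/differentiable_continuous/derivable1_diffP.
- move=> t; rewrite in_itv/= andbT => t0; rewrite derive1E.
  by have [] := dF t; first by apply: lt_trans t0; rewrite oppr_lt0.
Unshelve. all: by end_near.
Qed.

Lemma integral_cauchy_kernel e a b c : 0 < e -> a <= b ->
  (\int[leb]_(t in `]a, b]) (2 * e / (e ^+ 2 + (t + c) ^+ 2))%:E
   = (2 * (atan ((b + c) / e) - atan ((a + c) / e)))%:E)%E.
Proof.
move=> e0 ab.
have en0 : e != 0 by rewrite gt_eqF.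
have q0 t : e ^+ 2 + (t + c) ^+ 2 != 0 by rewrite gt_eqF// ltr_pwDl ?exprn_gt0// sqr_ge0.
pose F t := 2 * atan ((t + c) / e).
have dF t : is_derive t (1:R) F (2 * e / (e ^+ 2 + (t + c) ^+ 2)).
  have h1 : is_derive t 1 (fun s : R => (s + c) / e) e^-1.
    have -> : (fun s : R => (s + c) / e) = (fun s => c / e + s * e^-1).
      by apply/funext => s; rewrite mulrDl addrC.
    exact: is_derive_affine.
  have h3 := @is_derive1_comp _ atan (fun s => (s + c) / e) t _ _ (is_derive1_atan _) h1.
  apply: (is_derive_eq (is_deriveZ (2:R) h3)).
  rewrite /GRing.scale /=; field.
  by rewrite en0 q0 andbT.
have cf : continuous (fun t => 2 * e / (e ^+ 2 + (t + c) ^+ 2)).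
  move=> t; apply: cvgM; first exact: cvg_cst.
  apply: cvgV => //; apply: cvgD; first exact: cvg_cst.
  have h1 : {for t, continuous (fun s : R => s + c)}.
    by apply: cvgD; [exact: cvg_id|exact: cvg_cst].
  exact: (@continuous_comp _ _ _ (fun s : R => s + c) (fun s : R => s ^+ 2) t h1
    (@exprn_continuous _ 2 _)).
have cF := cont_of_derive dF.
rewrite le_eqVlt in ab; case/orP: ab => [/eqP ->|ab].
  by rewrite set_itvoc0 integral_set0 subrr mulr0.
rewrite integral_itv_obnd_cbnd; last first.
  by apply/measurable_EFinP/measurable_funTS; exact: continuous_measurable_fun.
rewrite (@continuous_FTC2 _ _ F)//.
- by rewrite -EFinB /F mulrBr.
- exact: continuous_subspaceT.
- split=> [t _||]; first by case: (dF t).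
    by apply: cvg_at_right_filter; exact: cF.
  by apply: cvg_at_left_filter; exact: cF.
- by move=> t _; rewrite derive1E; case: (dF t).
Qed.

End one_dimensional_integrals.

(** * Integrals over row vectors, one coordinate at a time *)

Section row_vector_integrals.
Variable R : realType.
Implicit Types (n : nat) (e A B th : R).
Local Notation leb := (@lebesgue_measure R).
Local Notation lam := (lebesgue_rV R).

Lemma continuous_measurable_rV n (f : 'rV[R]_n -> R) :
  continuous f -> measurable_fun setT f.
Proof.
move=> cf; apply: (measurability _ (RGenOpens.measurableE R)).
move=> _ [_ [a [b ->] <-]]; rewrite setTI; apply: open_measurable_rV.
by apply: open_comp; [move=> v _; exact: cf|exact: interval_open].
Qed.

Lemma measurable_dot dT (T : measurableType dT) n (f g : T -> 'rV[R]_n) :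
  measurable_fun setT f -> measurable_fun setT g ->
  measurable_fun setT (fun t => dot (f t) (g t)).
Proof.
move=> mf mg; apply: measurable_sum => i.
by apply: measurable_funM; apply: measurableT_comp (measurable_coord _ _) _.
Qed.

Lemma measurable_cosT dT (T : measurableType dT) (f : T -> R) :
  measurable_fun setT f -> measurable_fun setT (fun t => cos (f t)).
Proof.
move=> mf; apply: measurableT_comp mf.
by apply: continuous_measurable_fun; exact: continuous_cos.
Qed.

Lemma measurable_sinT dT (T : measurableType dT) (f : T -> R) :
  measurable_fun setT f -> measurable_fun setT (fun t => sin (f t)).
Proof.
move=> mf; apply: measurableT_comp mf.
by apply: continuous_measurable_fun; exact: continuous_sin.
Qed.

Lemma measurable_prodT dT (T : measurableType dT) n (f : 'I_n -> T -> R) :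
  (forall i, measurable_fun setT (f i)) ->
  measurable_fun setT (fun t => \prod_(i < n) f i t).
Proof. by move=> mf; apply: measurable_prod => i _; exact: mf. Qed.

Lemma ge0_integral_rVS n (f : 'rV[R]_n.+1 -> \bar R) :
  measurable_fun setT f -> (forall v, 0 <= f v)%E ->
  (\int[lam n.+1]_v f v = \int[leb]_t \int[lam n]_v f (rV_cons (t, v)))%E.
Proof.
move=> mf f0; rewrite /= /lebesgue_rV_step.
rewrite ge0_integral_pushforward//; last exact: measurable_rV_cons.
rewrite preimage_setT fubini_tonelli1//; last by move=> p; exact: f0.
by apply: measurableT_comp => //; exact: measurable_rV_cons.
Qed.

Lemma rV_cons0 n t (v : 'rV[R]_n) : rV_cons (t, v) ord0 ord0 = t.
Proof. by rewrite mxE unlift_none. Qed.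

Lemma rV_consS n t (v : 'rV[R]_n) i : rV_cons (t, v) ord0 (lift ord0 i) = v ord0 i.
Proof. by rewrite mxE liftK. Qed.

Lemma integral_prod_rV n (g : 'I_n -> R -> R) (c : 'I_n -> R) :
  (forall i, measurable_fun setT (g i)) -> (forall i t, 0 <= g i t) ->
  (forall i, \int[leb]_t (g i t)%:E = (c i)%:E)%E ->
  (\int[lam n]_v (\prod_(i < n) g i (v ord0 i))%:E = (\prod_(i < n) c i)%:E)%E.
Proof.
elim: n g c => [|n IH] g c mg g0 gc.
  under eq_integral do rewrite big_ord0.
  by rewrite integral_dirac// diracE mem_set// mul1e big_ord0.
have mF m (h : 'I_m -> R -> R) : (forall i, measurable_fun setT (h i)) ->
    measurable_fun setT (fun v : 'rV[R]_m => (\prod_(i < m) h i (v ord0 i))%:E).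
  move=> mh; apply/measurable_EFinP/measurable_prodT => i.
  by apply: (measurableT_comp (mh i)); exact: measurable_coord.
rewrite ge0_integral_rVS; last 2 first.
- exact: mF.
- by move=> v; rewrite lee_fin prodr_ge0.
transitivity (\int[leb]_t ((\prod_(i < n) c (lift ord0 i))%:E * (g ord0 t)%:E))%E.
  apply: eq_integral => t _.
  rewrite -(IH (fun i => g (lift ord0 i)) (fun i => c (lift ord0 i)))//.
  rewrite muleC -ge0_integralZl_EFin//.
  - apply: eq_integral => v _; rewrite big_ord_recl rV_cons0 EFinM; congr (_ * _%:E)%E.
    by apply: eq_bigr => i _; rewrite rV_consS.
  - by move=> v _; rewrite lee_fin prodr_ge0.
  - exact: (mF _ (fun i => g (lift ord0 i))).
rewrite ge0_integralZl_EFin//.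
- by rewrite gc -EFinM big_ord_recl mulrC.
- by move=> t _; rewrite lee_fin.
- by apply/measurable_EFinP; exact: mg.
- apply: prodr_ge0 => i _; rewrite -lee_fin -gc.
  by apply: integral_ge0 => t _; rewrite lee_fin.
Qed.

(** The family [A + B * cos (th + _)] with [|B| <= A] is stable under integrating out coordinates,
    which is why the induction runs over all [A], [B] and [th]. The first coordinate is absorbed
    into the phase; the others turn [A] into [A * (2 / e) ^+ n] and [B] into [B * P], and
    [P <= (2 / e) ^+ n] preserves the inequality. *)
Lemma integral_expR_cos_rV n e A B th (x : 'rV[R]_n) : 0 < e -> `|B| <= A ->
  (\int[lam n]_u ((\prod_(i < n) expR (- (e * `|u ord0 i|)))
     * (A + B * cos (th + dot u x)))%:E
   = (A * (2 / e) ^+ n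
      + B * cos th * \prod_(i < n) (2 * e / (e ^+ 2 + x ord0 i ^+ 2)))%:E)%E.
Proof.
move=> e0; elim: n A B th x => [|n IH] A B th x BA.
  under eq_integral do rewrite /dot !big_ord0 addr0 mul1r.
  by rewrite integral_dirac// diracE mem_set// mul1e big_ord0 expr0 !mulr1.
have mF m a b y : measurable_fun setT (fun u : 'rV[R]_m =>
    ((\prod_(i < m) expR (- (e * `|u ord0 i|))) * (A + B * cos (a + b * dot u y)))%:E).
  apply/measurable_EFinP/measurable_funM.
    apply: measurable_prodT => i; apply: measurableT_comp => //.
    apply: measurableT_comp => //; apply: measurable_funM => //.
    by apply: measurableT_comp => //; exact: measurable_coord.
  apply: measurable_funD => //; apply: measurable_funM => //.
  apply: measurable_cosT; apply: measurable_funD => //; apply: measurable_funM => //.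
  exact: measurable_dot.
have p0 m (u : 'rV[R]_m) : 0 <= \prod_(i < m) expR (- (e * `|u ord0 i|)).
  by apply: prodr_ge0 => i _; exact: expR_ge0.
rewrite ge0_integral_rVS; last 2 first.
- by have := mF n.+1 th 1 x; under eq_fun do rewrite mul1r.
- by move=> u; rewrite lee_fin mulr_ge0// addcos_ge0.
pose x' : 'rV[R]_n := \row_i x ord0 (lift ord0 i).
pose P := \prod_(i < n) (2 * e / (e ^+ 2 + x' ord0 i ^+ 2)).
have P0 : 0 <= P.
  apply: prodr_ge0 => i _; rewrite mulr_ge0 ?invr_ge0 ?addr_ge0 ?sqr_ge0//.
  by rewrite mulr_ge0// ltW.
have PP : P <= (2 / e) ^+ n.
  rewrite -[in leRHS](card_ord n) -prodr_const; apply: ler_prod => i _.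
  have q0 : 0 < e ^+ 2 + x' ord0 i ^+ 2 by rewrite ltr_pwDl ?exprn_gt0// sqr_ge0.
  rewrite mulr_ge0 ?invr_ge0 ?(ltW q0)//=; last by rewrite mulr_ge0// ltW.
  rewrite ler_pdivrMr// mulrAC ler_pdivlMr// -mulrA -expr2.
  by rewrite ler_pM2l// lerDl sqr_ge0.
transitivity (\int[leb]_t (expR (- (e * `|t|)) *
    (A * (2 / e) ^+ n + (B * P) * cos (th + t * x ord0 ord0)))%:E)%E.
  apply: eq_integral => t _.
  transitivity (\int[lam n]_v ((expR (- (e * `|t|)))%:E *
     ((\prod_(i < n) expR (- (e * `|v ord0 i|)))
     * (A + B * cos ((th + t * x ord0 ord0) + dot v x')))%:E))%E.
    apply: eq_integral => v _; rewrite -EFinM mulrA; congr ((_ * _)%:E).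
      rewrite big_ord_recl rV_cons0; congr (_ * _).
      by apply: eq_bigr => i _; rewrite rV_consS.
    congr (_ + _ * cos _); rewrite /dot big_ord_recl rV_cons0 addrA; congr (_ + _).
    by apply: eq_bigr => i _; rewrite rV_consS mxE.
  rewrite ge0_integralZl_EFin ?expR_ge0//.
  - by rewrite IH// -EFinM [B * _ * P]mulrAC.
  - by move=> v _; rewrite lee_fin mulr_ge0// addcos_ge0.
  - by have := mF n (th + t * x ord0 ord0) 1 x'; under eq_fun do rewrite mul1r.
rewrite integral_expR_cos//.
  rewrite [(2 / e) ^+ n.+1]exprS big_ord_recl; congr EFin.
  have -> : \prod_(i < n) (2 * e / (e ^+ 2 + x ord0 (lift ord0 i) ^+ 2)) = P.
    by apply: eq_bigr => i _; rewrite mxE.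
  by move: (cos th) => c; ring.
by rewrite normrM (ger0_norm P0) ler_pM.
Qed.

Lemma integral_prod_powR_tail n K al : 0 < K -> 0 < al ->
  (\int[lam n]_u (\prod_(i < n) (K + `|u ord0 i|) `^ (- al - 1))%:E
   = ((2 * K `^ (- al) / al) ^+ n)%:E)%E.
Proof.
move=> K0 al0.
rewrite (integral_prod_rV (c := fun=> 2 * K `^ (- al) / al)
  (g := fun _ t => (K + `|t|) `^ (- al - 1)))//.
- by rewrite prodr_const card_ord.
- by move=> _; apply: measurableT_comp (measurable_powR _) _; apply: measurable_funD.
- by move=> i t; exact: powR_ge0.
- by move=> i; exact: integral_powR_tail.
Qed.

End row_vector_integrals.

(** * Bounded and dominated integrands; the scalar product *)

Section integral_auxiliaries.
Context d (T : measurableType d) (R : realType).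

Lemma RintegralE (m : {measure set T -> \bar R}) (D : set T) (f : T -> R) :
  measurable D -> m.-integrable D (EFin \o f) ->
  (\int[m]_(x in D) f x)%:E = (\int[m]_(x in D) (f x)%:E)%E.
Proof. by move=> mD fi; rewrite /Rintegral fineK//; exact: integrable_fin_num. Qed.

Lemma le_normr_integrable (m : {measure set T -> \bar R}) (D : set T) (f g : T -> R) :
  measurable D -> measurable_fun D f -> (forall x, D x -> `|f x| <= g x) ->
  m.-integrable D (EFin \o g) -> m.-integrable D (EFin \o f).
Proof.
move=> mD mf fg gi; apply: (le_integrable mD _ _ gi); first exact/measurable_EFinP.
move=> x Dx /=; rewrite lee_fin; apply: (le_trans (fg _ Dx)); exact: ler_norm.
Qed.

Lemma bounded_integrable (m : {finite_measure set T -> \bar R}) (D : set T)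
    (f : T -> R) C :
  measurable D -> measurable_fun D f -> (forall x, D x -> `|f x| <= C) ->
  m.-integrable D (EFin \o f).
Proof.
move=> mD mf fC; apply: (@le_normr_integrable _ _ _ (cst C)) => //.
exact: finite_measure_integrable_cst.
Qed.

Lemma cvg_integral_dominated (m : {measure set T -> \bar R}) (D : set T)
    (f_ : nat -> T -> R) (f g : T -> R) :
  measurable D -> (forall k, measurable_fun D (f_ k)) ->
  (forall x, D x -> f_ ^~ x @ \oo --> f x) ->
  m.-integrable D (EFin \o g) -> (forall k x, D x -> `|f_ k x| <= g x) ->
  (\int[m]_(x in D) (f_ k x)%:E)%E @[k --> \oo] --> (\int[m]_(x in D) (f x)%:E)%E.
Proof.
move=> mD mf cf gi fg.
apply: (@dominated_cvg _ _ _ m D mD (fun k x => (f_ k x)%:E) (fun x => (f x)%:E) (EFin \o g)) => //.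
- by move=> k; exact/measurable_EFinP.
- by move=> x Dx; apply/cvg_EFin; [exact: nearW|exact: cf].
Qed.

End integral_auxiliaries.

Section dot_theory.
Variables (R : realType) (n : nat).
Implicit Types (u v x y : 'rV[R]_n).

Lemma dotBr u x y : dot u (x - y) = dot u x - dot u y.
Proof. by rewrite /dot -sumrB; apply: eq_bigr => i _; rewrite !mxE mulrBr. Qed.

Lemma continuous_dot u : continuous (dot u).
Proof.
apply: (@continuous_big _ _ _ _ xpredT); first exact: add_continuous.
move=> i _ x; exact: (@continuous_comp _ _ _ (fun v : 'rV[R]_n => v ord0 i)
  ( *%R (u ord0 i)) x (@coord_continuous _ _ _ _ _ _) (@mulrl_continuous _ _ _)).
Qed.

End dot_theory.

(** * The damped inversion formula *)

Section fourier_inversion.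
Variables (R : realType) (n : nat) (mu : probability 'rV[R]_n R).
Implicit Types (u x y : 'rV[R]_n) (e : R).
Local Notation lam := (lebesgue_rV R n).

Definition cos_mean u : R := \int[mu]_y cos (dot u y).
Definition sin_mean u : R := \int[mu]_y sin (dot u y).

(* real part of e^{i<u,x>} times the conjugate of the characteristic function *)
Definition inversion_integrand u x : R :=
  cos (dot u x) * cos_mean u + sin (dot u x) * sin_mean u.

Local Notation psi := inversion_integrand.

Lemma measurable_cos_dot u x : measurable_fun setT (fun y => cos (dot u (x - y))).
Proof.
apply: measurable_cosT; under eq_fun do rewrite dotBr.
by apply: measurable_funB => //; exact: measurable_dot.
Qed.

Lemma cos_norm_le1 (t : R) : `|cos t| <= 1.
Proof. by rewrite ler_norml cos_geN1 cos_le1. Qed.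

Lemma sin_norm_le1 (t : R) : `|sin t| <= 1.
Proof. by rewrite ler_norml sin_geN1 sin_le1. Qed.

Lemma integrable_cos_dot u x : mu.-integrable setT (EFin \o (fun y => cos (dot u (x - y)))).
Proof.
apply: (@bounded_integrable _ _ _ _ _ _ 1) => //; first exact: measurable_cos_dot.
by move=> y _; exact: cos_norm_le1.
Qed.

Lemma inversion_integrandE u x : psi u x = \int[mu]_y cos (dot u (x - y)).
Proof.
have mc : mu.-integrable setT (EFin \o (fun y => cos (dot u y))).
  apply: (@bounded_integrable _ _ _ _ _ _ 1) => //; last by move=> y _; exact: cos_norm_le1.
  by apply: measurable_cosT; exact: measurable_dot.
have ms : mu.-integrable setT (EFin \o (fun y => sin (dot u y))).
  apply: (@bounded_integrable _ _ _ _ _ _ 1) => //; last by move=> y _; exact: sin_norm_le1.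
  by apply: measurable_sinT; exact: measurable_dot.
rewrite /psi /cos_mean /sin_mean -!RintegralZl// -RintegralD//.
- by apply: eq_Rintegral => y _; rewrite dotBr cosB.
- exact: (integrableZl measurableT (cos (dot u x)) mc).
- exact: (integrableZl measurableT (sin (dot u x)) ms).
Qed.

(** The integrand on the right is nonnegative, so this form gives both the measurability of
    [inversion_integrand] in [u] and the exchange of integrals by Tonelli. *)
Lemma add1_inversion_integrand u x :
  (1 + psi u x)%:E = (\int[mu]_y (1 + cos (dot u (x - y)))%:E)%E.
Proof.
rewrite -RintegralE//; last first.
  apply: (@bounded_integrable _ _ _ _ _ _ 2) => //.
    by apply: measurable_funD => //; exact: measurable_cos_dot.
  move=> y _; apply: (le_trans (ler_normD _ _)); rewrite normr1.
  by have := cos_norm_le1 (dot u (x - y)); lra.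
congr EFin; rewrite inversion_integrandE RintegralD//.
- congr (_ + _); rewrite Rintegral_cst//.
  by rewrite mul1r; apply/esym/(congr1 fine (@probability_setT _ _ _ mu)).
- exact: finite_measure_integrable_cst.
- exact: integrable_cos_dot.
Qed.

(** Cauchy-Schwarz in the plane, by Lagrange's identity for the unit vector (cos, sin) and the
    vector of the two means. The right-hand side is the modulus of the characteristic function. *)
Lemma norm_inversion_integrand_le u x :
  `|psi u x| <= Num.sqrt (cos_mean u ^+ 2 + sin_mean u ^+ 2).
Proof.
rewrite -sqrtr_sqr; apply: ler_wsqrtr; rewrite /psi.
have := cos2Dsin2 (dot u x); move: (cos (dot u x)) (sin _) (cos_mean u) (sin_mean u).
move=> c s a b cs; rewrite -subr_ge0.
have -> : a ^+ 2 + b ^+ 2 - (c * a + s * b) ^+ 2 = (c * b - s * a) ^+ 2.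
  by rewrite -{1}[a ^+ 2]mul1r -{1}[b ^+ 2]mul1r -cs; ring.
exact: sqr_ge0.
Qed.

Lemma measurable_kernel_joint (f : R -> R) x :
  measurable_fun setT f ->
  measurable_fun [set: 'rV[R]_n * 'rV[R]_n]
    (fun p => f (dot p.1 (x - p.2))).
Proof.
move=> mf; apply: measurableT_comp mf _.
under eq_fun do rewrite dotBr.
apply: measurable_funB; apply: measurable_dot => //; exact: measurable_fst || exact: measurable_snd.
Qed.

Lemma measurable_add1_cos_joint x :
  measurable_fun [set: 'rV[R]_n * 'rV[R]_n]
    (fun p => 1 + cos (dot p.1 (x - p.2))).
Proof.
apply: measurable_funD => //; apply: (@measurable_kernel_joint cos).
by apply: continuous_measurable_fun; exact: continuous_cos.
Qed.

Lemma add1_cos_ge0 (t : R) : 0 <= 1 + cos t.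
Proof. by have := cos_geN1 t; lra. Qed.

Lemma measurable_inversion_integrand x : measurable_fun setT (psi^~ x).
Proof.
have h : measurable_fun setT (fun u => (1 + psi u x)%:E).
  under eq_fun do rewrite add1_inversion_integrand.
  apply: (@measurable_fun_fubini_tonelli_F _ _ _ _ _ mu
    (fun p : 'rV[R]_n * 'rV[R]_n => (1 + cos (dot p.1 (x - p.2)))%:E)).
    by apply/measurable_EFinP; exact: measurable_add1_cos_joint.
  by move=> p; rewrite lee_fin add1_cos_ge0.
have -> : psi^~ x = (fun u => (1 + psi u x) - 1) by apply/funext => u; rewrite addrC addKr.
by apply: measurable_funB => //; exact/measurable_EFinP.
Qed.

Definition damping e u : R := \prod_(i < n) expR (- (e * `|u ord0 i|)).

(** The Fourier transform of [damping e]: (2 pi)^n times the product of the centred Cauchy densities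
    of scale [e]. *)
Definition cauchy_kernel e x : R := \prod_(i < n) (2 * e / (e ^+ 2 + x ord0 i ^+ 2)).

Lemma damping_ge0 e u : 0 <= damping e u.
Proof. by apply: prodr_ge0 => i _; exact: expR_ge0. Qed.

Lemma damping_le1 e u : 0 <= e -> damping e u <= 1.
Proof.
move=> e0; apply: prodr_ile1 => i _; rewrite expR_ge0/= -expR0 ler_expR oppr_le0.
by rewrite mulr_ge0.
Qed.

Lemma measurable_damping e : measurable_fun setT (damping e).
Proof.
apply: measurable_prodT => i; apply: measurableT_comp => //.
apply: measurableT_comp => //; apply: measurable_funM => //.
by apply: measurableT_comp => //; exact: measurable_coord.
Qed.

Lemma ge0_integral_damping e : 0 < e ->
  (\int[lam]_u (damping e u)%:E = ((2 / e) ^+ n)%:E)%E.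
Proof.
move=> e0.
transitivity (\int[lam]_u (damping e u * (1 + 0 * cos (0 + dot u 0)))%:E)%E.
  by apply: eq_integral => u _; rewrite mul0r addr0 mulr1.
by rewrite integral_expR_cos_rV ?normr0// !mul0r addr0 mul1r.
Qed.

Lemma integrable_damping e : 0 < e -> lam.-integrable setT (EFin \o damping e).
Proof.
move=> e0; apply/integrableP; split.
  by apply/measurable_EFinP; exact: measurable_damping.
under eq_integral => u _ do rewrite /= ger0_norm ?damping_ge0//.
by rewrite ge0_integral_damping// ltry.
Qed.

Lemma integral_damping e : 0 < e -> \int[lam]_u damping e u = (2 / e) ^+ n.
Proof.
move=> e0; apply: EFin_inj; rewrite RintegralE//; last exact: integrable_damping.
exact: ge0_integral_damping.
Qed.

Lemma cauchy_kernel_ge0 e x : 0 < e -> 0 <= cauchy_kernel e x.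
Proof.
move=> e0; apply: prodr_ge0 => i _; rewrite mulr_ge0 ?invr_ge0 ?addr_ge0 ?sqr_ge0//.
by rewrite mulr_ge0// ltW.
Qed.

Lemma cauchy_kernel_le e x : 0 < e -> cauchy_kernel e x <= (2 / e) ^+ n.
Proof.
move=> e0; rewrite -[in leRHS](card_ord n) -prodr_const; apply: ler_prod => i _.
have q0 : 0 < e ^+ 2 + x ord0 i ^+ 2 by rewrite ltr_pwDl ?exprn_gt0// sqr_ge0.
rewrite mulr_ge0 ?invr_ge0 ?(ltW q0)//=; last by rewrite mulr_ge0// ltW.
rewrite ler_pdivrMr// mulrAC ler_pdivlMr// -mulrA -expr2.
by rewrite ler_pM2l// lerDl sqr_ge0.
Qed.

Lemma measurable_cauchy_factor e : 0 < e ->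
  measurable_fun setT (fun t : R => 2 * e / (e ^+ 2 + t ^+ 2)).
Proof.
move=> e0; apply: continuous_measurable_fun => t; apply: cvgM; first exact: cvg_cst.
apply: cvgV; first by rewrite gt_eqF// ltr_pwDl ?exprn_gt0// sqr_ge0.
apply: cvgD; first exact: cvg_cst.
exact: exprn_continuous.
Qed.

Lemma measurable_cauchy_kernel dT (T : measurableType dT) e (f : T -> 'rV[R]_n) :
  0 < e -> measurable_fun setT f ->
  measurable_fun setT (fun t => cauchy_kernel e (f t)).
Proof.
move=> e0 mf; apply: measurable_prodT => i.
apply: (measurableT_comp (measurable_cauchy_factor e0)).
exact: (measurableT_comp (measurable_coord _ _) mf).
Qed.

Lemma measurable_rV_sub dT (T : measurableType dT) (f g : T -> 'rV[R]_n) :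
  measurable_fun setT f -> measurable_fun setT g ->
  measurable_fun setT (fun t => f t - g t).
Proof.
move=> mf mg; apply: measurable_fun_rV => j; under eq_fun do rewrite !mxE.
by apply: measurable_funB; [exact: (measurableT_comp (measurable_coord _ _) mf)|
  exact: (measurableT_comp (measurable_coord _ _) mg)].
Qed.

Lemma integrable_cauchy_kernel e x : 0 < e ->
  mu.-integrable setT (EFin \o (fun y => cauchy_kernel e (x - y))).
Proof.
move=> e0; apply: (@bounded_integrable _ _ _ _ _ _ ((2 / e) ^+ n)) => //.
  by apply: measurable_cauchy_kernel => //; exact: measurable_rV_sub.
by move=> y _; rewrite ger0_norm ?cauchy_kernel_ge0// cauchy_kernel_le.
Qed.

Variable B : 'rV[R]_n -> R.
Hypothesis psiB : forall u x, `|psi u x| <= B u.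
Hypothesis intB : lam.-integrable setT (EFin \o B).

Lemma integrable_damped e x : 0 < e ->
  lam.-integrable setT (EFin \o (fun u => damping e u * psi u x)).
Proof.
move=> e0; apply: (le_normr_integrable _ _ _ intB) => //.
  by apply: measurable_funM; [exact: measurable_damping|exact: measurable_inversion_integrand].
move=> u _; rewrite normrM ger0_norm ?damping_ge0//; apply: le_trans (psiB u x).
by rewrite ler_piMl// damping_le1// ltW.
Qed.

Lemma integrable_inversion_integrand x : lam.-integrable setT (EFin \o (psi^~ x)).
Proof.
apply: (le_normr_integrable _ _ _ intB) => //; first exact: measurable_inversion_integrand.
Qed.

(* Tonelli applies once cos is replaced by 1 + cos >= 0. *)
Lemma integral_damped e x : 0 < e ->
  \int[lam]_u (damping e u * psi u x) = \int[mu]_y cauchy_kernel e (x - y).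
Proof.
move=> e0.
have mH := @measurable_damping e.
have h1 : (\int[lam]_u (damping e u * (1 + psi u x))%:E =
    \int[mu]_y ((2 / e) ^+ n + cauchy_kernel e (x - y))%:E)%E.
  transitivity (\int[lam]_u \int[mu]_y (damping e u * (1 + cos (dot u (x - y))))%:E)%E.
    apply: eq_integral => u _; rewrite EFinM add1_inversion_integrand.
    rewrite -ge0_integralZl_EFin ?damping_ge0//.
    by apply/measurable_EFinP/measurable_funD => //; exact: measurable_cos_dot.
  rewrite (fubini_tonelli (m1 := lam) (m2 := mu)
    (fun p : 'rV[R]_n * 'rV[R]_n => (damping e p.1 * (1 + cos (dot p.1 (x - p.2))))%:E)).
  - apply: eq_integral => y _.
    transitivity (\int[lam]_u (damping e u * (1 + 1 * cos (0 + dot u (x - y))))%:E)%E.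
      by apply: eq_integral => u _; rewrite mul1r add0r.
    by rewrite integral_expR_cos_rV ?normr1// cos0 !mul1r.
  - apply/measurable_EFinP/measurable_funM; last exact: measurable_add1_cos_joint.
    by apply: (measurableT_comp mH); exact: measurable_fst.
  - by move=> p; rewrite lee_fin mulr_ge0// ?damping_ge0// add1_cos_ge0.
have h2 : \int[lam]_u (damping e u * (1 + psi u x)) =
    \int[mu]_y ((2 / e) ^+ n + cauchy_kernel e (x - y)) by rewrite /Rintegral h1.
rewrite RintegralD// in h2; last 2 first.
- exact: finite_measure_integrable_cst.
- exact: integrable_cauchy_kernel.
(* The added 1 has produced [(2 / e) ^+ n] on both sides: the total mass of the damping on the left,
   a constant integrated against a probability on the right. This number is finite, so it can be
   cancelled. *)
move: h2; under eq_Rintegral => u _ do rewrite mulrDr mulr1.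
rewrite RintegralD//; [|exact: integrable_damping|exact: integrable_damped].
rewrite integral_damping// Rintegral_cst// (congr1 fine (@probability_setT _ _ _ mu)) mulr1.
by move/addrI.
Qed.

End fourier_inversion.

(** * The measure with a given density *)

Section density_measure.
Context d (T : measurableType d) (R : realType) (m : {measure set T -> \bar R}).
Variable f : T -> R.

(** The two proofs are arguments so that the measure structure can be attached to the term
    [density_measure f0 mf] itself. *)
Definition density_measure of (forall x, 0 <= f x) & measurable_fun setT f :=
  fun A : set T => (\int[m]_(x in A) (f x)%:E)%E.

Hypotheses (f0 : forall x, 0 <= f x) (mf : measurable_fun setT f).

Let density_measure0 : density_measure f0 mf set0 = 0%E.
Proof. by rewrite /density_measure integral_set0. Qed.

Let density_measure_ge0 A : (0 <= density_measure f0 mf A)%E.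
Proof. by apply: integral_ge0 => x _; rewrite lee_fin. Qed.

Let density_measure_sigma_additive : semi_sigma_additive (density_measure f0 mf).
Proof.
move=> /= F mF tF mUF; rewrite /density_measure; apply: cvg_toP.
  apply: ereal_nondecreasing_is_cvgn => i j ij.
  apply: lee_sum_nneg_natr => // k _ _; apply: integral_ge0 => /= x Fkx.
  by rewrite lee_fin.
rewrite ge0_integral_bigcup//=.
- exact/measurable_funTS/measurable_EFinP.
- by move=> x _; rewrite lee_fin.
Qed.

HB.instance Definition _ := isMeasure.Build _ _ _ (density_measure f0 mf)
  density_measure0 density_measure_ge0 density_measure_sigma_additive.

End density_measure.

(** * Half-open boxes as a generating class stable under intersection *)

Section boxes.
Variables (R : realType) (n : nat).
Implicit Types (a b x : 'rV[R]_n).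

Definition rV_box a b : set 'rV[R]_n :=
  [set x | forall i, a ord0 i < x ord0 i <= b ord0 i].

(** The nontrivial inclusion says that the identity, from the sigma-algebra generated by boxes to
    the Borel one, is measurable. This is tested coordinatewise on half-lines: the set where
    coordinate j exceeds c is the union over k of the boxes with lower bound c in coordinate j, -k
    in the others, and upper bounds k. *)
Lemma measurable_rV_boxes :
  @measurable _ 'rV[R]_n = <<s [set A | exists a b, A = rV_box a b] >>.
Proof.
set G := [set A | _].
apply/seteqP; split => [A mA|]; last first.
  apply: smallest_sub; first exact: sigma_algebra_measurable.
  by move=> _ [a [b ->]]; exact: measurable_rV_box.
pose T := g_sigma_algebraType G.
suff h : measurable_fun [set: T] (id : T -> 'rV[R]_n).
  have := h measurableT A mA; rewrite setTI preimage_id.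
  by [].
apply: measurable_fun_rV => j.
apply: (measurability _ (RGenOInfty.measurableE R)).
move=> _ [_ [c ->] <-]; rewrite setTI.
pose a (k : nat) : 'rV[R]_n := \row_i (if i == j then c else - k%:R).
pose b (k : nat) : 'rV[R]_n := const_mx k%:R.
have -> : (fun t : T => (t : 'rV[R]_n) ord0 j) @^-1` `]c, +oo[%classic =
    \bigcup_k rV_box (a k) (b k).
  apply/seteqP; split => [x|x [k _]] /=; rewrite in_itv/= andbT; last first.
    by move=> /(_ j); rewrite !mxE eqxx => /andP[].
  move=> cx; have [k kP] : exists k : nat, forall i, `|(x : 'rV[R]_n) ord0 i| < k%:R.
    exists (\max_i (Num.truncn `|(x : 'rV[R]_n) ord0 i|).+1)%N => i.
    apply: (lt_le_trans (truncnS_gt _)); rewrite ler_nat.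
    exact: (leq_bigmax (F := fun i => (Num.truncn `|(x : 'rV[R]_n) ord0 i|).+1)).
  exists k => // i; rewrite !mxE; have := kP i; rewrite ltr_norml => /andP[k1 k2].
  by rewrite (ltW k2) andbT; case: eqP => // ->.
apply: bigcupT_measurable => k; apply: sub_sigma_algebra.
by exists (a k), (b k).
Qed.

Lemma rV_boxI a b a' b' : rV_box a b `&` rV_box a' b' =
  rV_box (\row_i Num.max (a ord0 i) (a' ord0 i)) (\row_i Num.min (b ord0 i) (b' ord0 i)).
Proof.
apply/seteqP; split => x /=.
  move=> [h h'] i; have /andP[h1 h2] := h i; have /andP[h3 h4] := h' i.
  by rewrite !mxE gt_max le_min h1 h2 h3 h4.
move=> h; split => i; have := h i; rewrite !mxE gt_max le_min.
  by move=> /andP[/andP[-> _] /andP[-> _]].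
by move=> /andP[/andP[_ ->] /andP[_ ->]].
Qed.

Lemma indic_rV_box a b x :
  \1_(rV_box a b) x = \prod_(i < n) \1_(`]a ord0 i, b ord0 i]%classic) (x ord0 i) :> R.
Proof.
rewrite indicE; have [xab|xab] := boolP (x \in rV_box a b).
  rewrite big1// => i _; rewrite indicE mem_set//= in_itv/=.
  by move: xab; rewrite inE => /(_ i).
suff [i xi] : exists i, ~~ (a ord0 i < x ord0 i <= b ord0 i).
  by rewrite (bigD1 i)//= indicE memNset ?mul0r//= in_itv/=; exact/negP.
apply: contrapT => h; move/negP: xab; apply; rewrite inE => i.
by apply: contrapT => /negP xi; apply: h; exists i.
Qed.

Lemma integral_cauchy_kernel_box e a b (c : 'rV[R]_n) : 0 < e ->
  (forall i, a ord0 i <= b ord0 i) ->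
  (\int[lebesgue_rV R n]_x (\1_(rV_box a b) x * cauchy_kernel e (x + c))%:E =
   (\prod_(i < n) (2 * (atan ((b ord0 i + c ord0 i) / e)
                        - atan ((a ord0 i + c ord0 i) / e))))%:E)%E.
Proof.
move=> e0 ab.
rewrite -(integral_prod_rV (g := fun i t =>
  \1_(`]a ord0 i, b ord0 i]%classic) t * (2 * e / (e ^+ 2 + (t + c ord0 i) ^+ 2)))).
- apply: eq_integral => x _; rewrite indic_rV_box -big_split/=.
  by congr EFin; apply: eq_bigr => i _; rewrite mxE.
- move=> i; apply: measurable_funM; first exact: measurable_indic.
  apply: (measurableT_comp (measurable_cauchy_factor e0)).
  exact: measurable_funD.
- move=> i t; rewrite mulr_ge0// mulr_ge0// ?mulr_ge0 ?(ltW e0)// invr_ge0.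
  by rewrite addr_ge0 ?sqr_ge0.
- move=> i; rewrite -integral_cauchy_kernel// [RHS]integral_mkcond.
  apply: eq_integral => t _; rewrite patchE indicE.
  by case: ifP => _; rewrite ?mul1r ?mul0r.
Qed.

End boxes.

(** * Arctangent differences tending to the indicator of a half-open interval *)

Section atan_jump.
Variable R : realType.

Lemma cvg_natS : k.+1%:R @[k --> \oo] --> (+oo : set_system R).
Proof.
apply/cvgryPge => M; near=> k; apply: (@le_trans _ _ k%:R); last by rewrite ler_nat.
by near: k; exact: nbhs_infty_ger.
Unshelve. all: by end_near.
Qed.

Lemma cvg_natSV : k.+1%:R^-1 @[k --> \oo] --> (0 : R).
Proof.
apply/cvgrPdist_lt => e e0; have := near_infty_natSinv_lt (PosNum e0).
by apply: filterS => k; rewrite sub0r normrN ger0_norm ?invr_ge0.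
Qed.

(* The shift by 1/k decides the boundary case c = 0, being large compared to
   the scale 1/k^2. *)
Lemma cvg_atan_jump (c : R) :
  atan ((c + k.+1%:R^-1) / (k.+1%:R^-1 ^+ 2)) @[k --> \oo] -->
  (if 0 <= c then pi / 2 else - (pi / 2)).
Proof.
have E (k : nat) : (c + k.+1%:R^-1) / (k.+1%:R^-1 ^+ 2) = k.+1%:R * (c * k.+1%:R + 1) :> R.
  by field.
under eq_cvg do rewrite E.
have [c0|c0] := leP 0 c.
  apply: (@cvg_comp _ _ _ (fun k : nat => k.+1%:R * (c * k.+1%:R + 1)) (@atan R)
    _ (pinfty_nbhs R)); last exact: cvgy_atan.
  apply/cvgryPge => M; near=> k; apply: (@le_trans _ _ k.+1%:R).
    by near: k; have /cvgryPge := cvg_natS; exact.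
  by rewrite ler_peMr// lerDr mulr_ge0.
(* For [c < 0] the argument tends to -oo; oddness reduces this to the limit of [atan] at +oo. *)
have N (k : nat) : atan (k.+1%:R * (c * k.+1%:R + 1)) =
    - atan (- (k.+1%:R * (c * k.+1%:R + 1))) :> R by rewrite atanN opprK.
rewrite (funext N); apply: cvgN.
apply: (@cvg_comp _ _ _ (fun k : nat => - (k.+1%:R * (c * k.+1%:R + 1))) (@atan R)
    _ (pinfty_nbhs R)); last exact: cvgy_atan.
apply/cvgryPge => M; near=> k; apply: (@le_trans _ _ k.+1%:R).
  by near: k; have /cvgryPge := cvg_natS; exact.
rewrite -mulrN ler_peMr// opprD -mulNr lerBrDr -ler_pdivrMl ?oppr_gt0//.
by near: k; have /cvgryPge := cvg_natS; exact.
Unshelve. all: by end_near.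
Qed.

(** The jump counts the value 0 as positive. At y = b > a the first term is therefore already at
    pi/2 and y is included; at y = a both terms are at pi/2 and y is excluded. This is exactly the
    convention of []a, b]]. *)
Lemma cvg_atan_indic (a b y : R) : a <= b ->
  (atan ((b - y + k.+1%:R^-1) / (k.+1%:R^-1 ^+ 2))
   - atan ((a - y + k.+1%:R^-1) / (k.+1%:R^-1 ^+ 2))) / pi @[k --> \oo] -->
  (\1_(`]a, b]%classic) y : R).
Proof.
move=> ab.
have p0 : (pi : R) != 0 by rewrite gt_eqF// pi_gt0.
have -> : \1_(`]a, b]%classic) y =
    ((if 0 <= b - y then pi / 2 else - (pi / 2)) -
     (if 0 <= a - y then pi / 2 else - (pi / 2))) / pi :> R.
  rewrite indicE !subr_ge0 (_ : (y \in _) = (a < y <= b)); last first.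
    by apply/idP/idP; [rewrite inE/= in_itv|move=> h; rewrite inE/= in_itv].
  case: (leP y a) => ya; case: (leP y b) => yb/=; first by rewrite subrr mul0r.
  - by exfalso; have := lt_le_trans yb (le_trans ya ab); rewrite ltxx.
  - by rewrite opprK -splitr divff.
  - by rewrite subrr mul0r.
apply: cvgM; last exact: cvg_cst.
by apply: cvgB; exact: cvg_atan_jump.
Qed.

Lemma norm_atanB_le (s t : R) : `|(atan s - atan t) / pi| <= 1.
Proof.
rewrite normrM normfV (ger0_norm (pi_ge0 R)) ler_pdivrMr ?pi_gt0// mul1r ler_norml.
have := atan_gtNpi2 s; have := atan_ltpi2 s.
have := atan_gtNpi2 t; have := atan_ltpi2 t.
move: (atan s) (atan t) (pi : R) => u v p; lra.
Qed.

End atan_jump.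

(** * The inversion integral is a continuous density *)

Section inversion_density.
Variables (R : realType) (n : nat) (mu : probability 'rV[R]_n R).
Implicit Types (u x y : 'rV[R]_n) (e : R).
Local Notation lam := (lebesgue_rV R n).
Local Notation psi := (inversion_integrand mu).

Definition inversion_density x : R := (2 * pi) ^- n * \int[lam]_u psi u x.

Variable B : 'rV[R]_n -> R.
Hypothesis psiB : forall u x, `|psi u x| <= B u.
Hypothesis intB : lam.-integrable setT (EFin \o B).

Lemma continuous_inversion_integrand u : continuous (psi u).
Proof.
pose h (t : R) := cos t * cos_mean mu u + sin t * sin_mean mu u.
have ch : continuous h.
  move=> t; apply: cvgD; (apply: cvgM; last exact: cvg_cst).
    exact: continuous_cos.
  exact: continuous_sin.
move=> x; exact: (@continuous_comp _ _ _ (dot u) h x (@continuous_dot R n u x) (ch _)).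
Qed.

(** One dominated limit with two uses: the constant factor 1 along an arbitrary sequence gives
    continuity of the density, and the damping factor along shifted points gives convergence of the
    regularised densities. *)
Lemma cvg_damped (H : nat -> 'rV[R]_n -> R) (x_ : nat -> 'rV[R]_n) x :
  (forall k, measurable_fun setT (H k)) -> (forall k u, 0 <= H k u <= 1) ->
  (forall u, H k u @[k --> \oo] --> (1 : R)) -> x_ @ \oo --> x ->
  \int[lam]_u (H k u * psi u (x_ k)) @[k --> \oo] --> \int[lam]_u psi u x.
Proof.
move=> mH H01 H1 xx.
apply: (@fine_cvg _ _ _ _ (fun k => (\int[lam]_u (H k u * psi u (x_ k))%:E)%E)).
rewrite RintegralE//; last exact: (integrable_inversion_integrand psiB intB).
apply: (@cvg_integral_dominated _ _ _ _ _ (fun k u => H k u * psi u (x_ k)) _ B) => //.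
- by move=> k; apply: measurable_funM => //; exact: measurable_inversion_integrand.
- move=> u _; rewrite -[psi u x]mul1r; apply: cvgM; first exact: H1.
  by apply: (@cvg_comp _ _ _ x_ (psi u) _ (nbhs x)) => //; exact: continuous_inversion_integrand.
- move=> k u _; have /andP[h0 h1] := H01 k u.
  rewrite normrM ger0_norm//; apply: le_trans (psiB u (x_ k)).
  by rewrite ler_piMl.
Qed.

(** Dominated convergence is sequential, so a failure of continuity at [x] is turned into points
    within 1/(k+1) of [x] whose images stay outside a fixed ball. *)
Lemma continuous_inversion_density : continuous inversion_density.
Proof.
pose F := fun y => \int[lam]_u psi u y.
suff cF : continuous F.
  move=> x; exact: (@continuous_comp _ _ _ F ( *%R ((2 * pi) ^- n)) x (cF x)
    (@mulrl_continuous _ _ _)).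
move=> x A /nbhs_ballP[e /= e0 eA]; apply: contrapT => nP.
have ex (k : nat) : exists y, ball x k.+1%:R^-1 y /\ ~ ball (F x) e (F y).
  apply: contrapT => nex; apply: nP; apply/nbhs_ballP.
  exists k.+1%:R^-1; first by rewrite /= invr_gt0.
  by move=> y By; apply: eA; apply: contrapT => ny; apply: nex; exists y.
have [x_ xP] := choice ex.
have xx : x_ @ \oo --> x.
  apply/cvg_ballP => r r0; have := near_infty_natSinv_lt (PosNum r0).
  by apply: filterS => k kr; apply: le_ball (xP k).1; exact: ltW.
have /cvg_ballP/(_ e e0)[k _ /(_ k (leqnn k))] : F (x_ k) @[k --> \oo] --> F x.
  have := @cvg_damped (fun _ => cst 1) x_ x; under eq_fun do under eq_Rintegral do rewrite mul1r.
  apply => //; last by move=> u; exact: cvg_cst.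
  by move=> k u; rewrite ler01 lexx.
exact: (xP k).2.
Qed.

Lemma measurable_inversion_density : measurable_fun setT inversion_density.
Proof. by apply: continuous_measurable_rV; exact: continuous_inversion_density. Qed.

Let e_ (k : nat) : R := k.+1%:R^-1 ^+ 2.
Let s_ (k : nat) : 'rV[R]_n := const_mx k.+1%:R^-1.
Let f_ k x : R := (2 * pi) ^- n * \int[lam]_u (damping (e_ k) u * psi u (x + s_ k)).

Let e_gt0 k : 0 < e_ k. Proof. by rewrite exprn_gt0// invr_gt0. Qed.

(** The Cauchy form shows what the oscillating integral hides: nonnegativity, measurability in [x],
    and explicit integrals over boxes. *)
Let f_E k x : f_ k x = (2 * pi) ^- n * \int[mu]_y cauchy_kernel (e_ k) (x + s_ k - y).
Proof. by rewrite /f_ (integral_damped psiB intB). Qed.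

Let f_ge0 k x : 0 <= f_ k x.
Proof.
rewrite f_E mulr_ge0 ?invr_ge0 ?exprn_ge0 ?mulr_ge0 ?pi_ge0//.
by apply: Rintegral_ge0 => y _; exact: cauchy_kernel_ge0.
Qed.

Let cvg_s x : x + s_ k @[k --> \oo] --> x.
Proof.
apply/cvg_ballP => r r0; have := near_infty_natSinv_lt (PosNum r0).
apply: filterS => k kr; split => // i j; rewrite !mxE /ball/= opprD addrA subrr sub0r normrN.
by rewrite ger0_norm// invr_ge0.
Qed.

Let cvg_f_ x : f_ k x @[k --> \oo] --> inversion_density x.
Proof.
apply: cvgM; first exact: cvg_cst.
apply: (@cvg_damped (fun k => damping (e_ k)) (fun k => x + s_ k)) => //.
- by move=> k; exact: measurable_damping.
- by move=> k u; rewrite damping_ge0 damping_le1// ltW.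
- move=> u; have -> : (1 : R) = \prod_(i < n) 1 by rewrite big1.
  apply: (@cvg_big _ _ _ _ xpredT) => [|i _]; first exact: mul_continuous.
  apply: (@cvg_comp _ _ _ (fun k => - (e_ k * `|u ord0 i|)) expR _ (nbhs (0 : R))); last first.
    by have := @continuous_expR R 0; rewrite /continuous_at expR0.
  rewrite -oppr0; apply: cvgN; rewrite -(mul0r `|u ord0 i|); apply: cvgM; last exact: cvg_cst.
  rewrite -(mul0r (0 : R)); apply: cvgM; exact: cvg_natSV.
Qed.

Lemma inversion_density_ge0 x : 0 <= inversion_density x.
Proof.
have c := @cvg_f_ x.
rewrite -(cvg_lim _ c)//; apply: limr_ge; first exact: (cvgP _ c).
by apply: nearW => k; exact: f_ge0.
Qed.

Let C := (2 * pi) ^- n * \int[lam]_u B u.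

Let C0 : 0 <= (2 * pi : R) ^- n.
Proof. by rewrite invr_ge0 exprn_ge0// mulr_ge0// pi_ge0. Qed.

Let f_le k x : f_ k x <= C.
Proof.
rewrite /f_ /C ler_wpM2l//; apply: le_Rintegral => //.
  exact: (integrable_damped psiB intB).
move=> u _; apply: (le_trans (ler_norm _)).
rewrite normrM ger0_norm ?damping_ge0//; apply: le_trans (psiB u (x + s_ k)).
by rewrite ler_piMl// damping_le1// ltW.
Qed.

Let measurable_f_ k : measurable_fun setT (f_ k).
Proof.
rewrite (_ : f_ k = fun x =>
    (2 * pi) ^- n * \int[mu]_y cauchy_kernel (e_ k) (x + s_ k - y)); last first.
  by apply/funext => x; exact: f_E.
apply: measurable_funM => //.
apply: (measurableT_comp (f := fine)) => //.
apply: (@measurable_fun_fubini_tonelli_F _ _ _ _ _ mu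
    (fun p : 'rV[R]_n * 'rV[R]_n => (cauchy_kernel (e_ k) (p.1 + s_ k - p.2))%:E)).
  apply/measurable_EFinP/measurable_cauchy_kernel => //.
  under eq_fun do rewrite -[s_ k]opprK.
  by apply: measurable_rV_sub => //; exact: measurable_rV_sub.
by move=> p; rewrite lee_fin cauchy_kernel_ge0.
Qed.

Section box.
Variables a b : 'rV[R]_n.
Hypothesis ab : forall i, a ord0 i <= b ord0 i.

Let mbox : measurable (rV_box a b). Proof. exact: measurable_rV_box. Qed.

(** The mass of the box under the product of Cauchy laws of scale [e_ k] centred at [y - s_ k]. *)
Let g_ k y : R := \prod_(i < n)
   ((atan ((b ord0 i - y ord0 i + k.+1%:R^-1) / (k.+1%:R^-1 ^+ 2))
   - atan ((a ord0 i - y ord0 i + k.+1%:R^-1) / (k.+1%:R^-1 ^+ 2))) / pi).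

Let integral_f_ k :
  (\int[lam]_x (\1_(rV_box a b) x * f_ k x)%:E = \int[mu]_y (g_ k y)%:E)%E.
Proof.
pose K (p : 'rV[R]_n * 'rV[R]_n) : \bar R :=
  ((2 * pi) ^- n * (\1_(rV_box a b) p.1 * cauchy_kernel (e_ k) (p.1 + s_ k - p.2)))%:E.
have mK1 x : measurable_fun setT (fun y => cauchy_kernel (e_ k) (x + s_ k - y)).
  by apply: measurable_cauchy_kernel => //; exact: measurable_rV_sub.
have mK2 y : measurable_fun setT (fun x => cauchy_kernel (e_ k) (x + s_ k - y)).
  apply: measurable_cauchy_kernel => //; under eq_fun do rewrite -[s_ k]opprK.
  by apply: measurable_rV_sub => //; exact: measurable_rV_sub.
have i0 x : 0 <= \1_(rV_box a b) x :> R by rewrite indicE.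
transitivity (\int[lam]_x \int[mu]_y K (x, y))%E.
  apply: eq_integral => x _; rewrite f_E mulrCA EFinM EFinM RintegralE//; last first.
    exact: integrable_cauchy_kernel.
  rewrite -ge0_integralZl_EFin//; last 2 first.
  - by move=> y _; rewrite lee_fin cauchy_kernel_ge0.
  - exact/measurable_EFinP.
  rewrite -ge0_integralZl_EFin//; last 2 first.
  - by move=> y _; rewrite -EFinM lee_fin mulr_ge0// cauchy_kernel_ge0.
  - by apply/measurable_EFinP/measurable_funM.
rewrite (fubini_tonelli (m1 := lam) (m2 := mu) K); last 2 first.
- apply/measurable_EFinP/measurable_funM => //; apply: measurable_funM.
    apply: measurableT_comp; last exact: measurable_fst.
    exact: measurable_indic.
  apply: measurable_cauchy_kernel => //; under eq_fun do rewrite -[s_ k]opprK.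
  by apply: measurable_rV_sub; [exact: measurable_rV_sub|exact: measurable_snd].
- by move=> p; rewrite lee_fin mulr_ge0// mulr_ge0// cauchy_kernel_ge0.
apply: eq_integral => y _.
under eq_integral do rewrite /K/= EFinM.
rewrite ge0_integralZl_EFin//; last 2 first.
- by move=> x _; rewrite lee_fin mulr_ge0// cauchy_kernel_ge0.
- by apply/measurable_EFinP/measurable_funM.
under eq_integral do rewrite -addrA.
rewrite integral_cauchy_kernel_box// -EFinM; congr EFin.
(* One factor 2 pi goes to each coordinate and turns twice an arctangent difference into a Cauchy
   probability. *)
have -> : (2 * pi) ^- n = \prod_(i < n) (2 * pi : R)^-1.
  by rewrite prodr_const card_ord exprVn.
rewrite /g_ -big_split/=.
apply: eq_bigr => i _; rewrite !mxE [_ - y ord0 i]addrC !addrA.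
have p0 : (pi : R) != 0 by rewrite gt_eqF// pi_gt0.
by rewrite /e_ invfM mulrACA mulVf// mul1r mulrC.
Qed.

Let box_lty : (lam (rV_box a b) < +oo)%E.
Proof. by rewrite lebesgue_rV_box// ltry. Qed.

Let integrable_indic_box (c : R) : lam.-integrable setT (EFin \o (fun x => c * \1_(rV_box a b) x)).
Proof.
apply: (integrableZl measurableT c (f := EFin \o \1_(rV_box a b))).
apply/integrableP; split; first exact/measurable_EFinP/measurable_indic.
under eq_integral do rewrite /= ger0_norm//.
by rewrite integral_indic// setIT.
Qed.

(** The same numbers have two dominated limits: over the box, whose finite volume makes the uniform
    bound [C] integrable, and over the probability space, where products of Cauchy probabilities are
    bounded by 1. *)
Lemma inversion_density_box :
  mu (rV_box a b) = (\int[lam]_(x in rV_box a b) (inversion_density x)%:E)%E.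
Proof.
have L1 : (\int[lam]_x (\1_(rV_box a b) x * f_ k x)%:E @[k --> \oo] -->
    \int[lam]_x (\1_(rV_box a b) x * inversion_density x)%:E)%E.
  apply: (@cvg_integral_dominated _ _ _ _ _ (fun k x => \1_(rV_box a b) x * f_ k x) _
    (fun x => C * \1_(rV_box a b) x)) => //.
  - by move=> k; apply: measurable_funM => //; exact: measurable_indic.
  - by move=> x _; apply: cvgM; [exact: cvg_cst|exact: cvg_f_].
  - move=> k x _; rewrite mulrC ger0_norm; last by rewrite mulr_ge0 ?f_ge0// indicE.
    by rewrite ler_wpM2r// f_le.
have L2 : (\int[mu]_y (g_ k y)%:E @[k --> \oo] --> \int[mu]_y (\1_(rV_box a b) y)%:E)%E.
  apply: (@cvg_integral_dominated _ _ _ _ _ g_ _ (cst 1)) => //.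
  - move=> k; apply: measurable_prodT => i; apply: measurable_funM => //.
    have mh (c : R) : measurable_fun setT (fun y : 'rV[R]_n =>
        atan ((c - y ord0 i + k.+1%:R^-1) / (k.+1%:R^-1 ^+ 2))).
      apply: (measurableT_comp (f := @atan R)).
        by apply: continuous_measurable_fun; exact: continuous_atan.
      apply: measurable_funM => //; apply: measurable_funD => //.
      by apply: measurable_funB => //; exact: measurable_coord.
    exact: measurable_funB.
  - move=> y _; rewrite indic_rV_box.
    apply: (@cvg_big _ _ _ _ xpredT) => [|i _]; first exact: mul_continuous.
    exact: cvg_atan_indic.
  - exact: finite_measure_integrable_cst.
  - move=> k y _; rewrite /g_ normr_prod; apply: prodr_ile1 => i _.
    by rewrite normr_ge0 norm_atanB_le.
rewrite (funext integral_f_) in L1.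
have := cvg_unique _ L1 L2.
rewrite integral_indic// setIT => <-//.
rewrite [RHS]integral_mkcond; apply: eq_integral => x _; rewrite patchE indicE.
by case: ifP => _; rewrite ?mul1r ?mul0r.
Qed.

End box.

(** Two measures that agree on boxes coincide: boxes generate the Borel sets, are stable under
    intersection, and the centred ones exhaust the space with finite mass. *)
Lemma is_density_inversion : is_density mu inversion_density.
Proof.
have mf := measurable_inversion_density.
split => [//||A mA]; first exact: inversion_density_ge0.
pose nu := density_measure lam inversion_density_ge0 mf.
pose Gk (k : nat) : set 'rV[R]_n := rV_box (const_mx (- k%:R)) (const_mx k%:R).
apply: (@measure_unique _ _ _ [set A | exists a b, A = rV_box a b] Gk
  (measurable_rV_boxes R n) _ _ _ mu nu) => //.
- move=> _ _ [a [b ->]] [a' [b' ->]]; rewrite rV_boxI.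
  by eexists; eexists; reflexivity.
- by move=> k; exists (const_mx (- k%:R)), (const_mx k%:R).
- apply/seteqP; split => // x _.
  exists (\max_i (Num.truncn `|x ord0 i|).+1)%N => // i; rewrite !mxE.
  have : `|x ord0 i| < (\max_i (Num.truncn `|x ord0 i|).+1)%N%:R.
    apply: (lt_le_trans (truncnS_gt _)); rewrite ler_nat.
    exact: (leq_bigmax (F := fun i => (Num.truncn `|x ord0 i|).+1)).
  by rewrite ltr_norml => /andP[-> /ltW ->].
- move=> _ [a [b ->]].
  (* The generating class also contains boxes with reversed bounds; these are empty. *)
  have [ab|/existsNP[i /negP]] := pselect (forall i, a ord0 i <= b ord0 i).
    exact: inversion_density_box.
  rewrite -ltNge => ba; suff -> : rV_box a b = set0 by rewrite !measure0.
  apply/seteqP; split => // x /(_ i) /andP[h1 h2].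
  by have := lt_trans (lt_le_trans h1 h2) ba; rewrite ltxx.
- by move=> k; rewrite (le_lt_trans (probability_le1 _ _))// ?ltry//; exact: measurable_rV_box.
Qed.

End inversion_density.

(** * Power estimates for the two-regime bound *)

Section powR_estimates.
Variable R : realType.
Implicit Types (x y q K r D c w : R).

Lemma le_powRN x y q : 0 < x -> x <= y -> 0 <= q -> y `^ (- q) <= x `^ (- q).
Proof.
move=> x0 xy q0; rewrite !powRN lef_pV2 ?posrE ?powR_gt0//; last exact: lt_le_trans xy.
by apply: ge0_ler_powR => //; rewrite nnegrE ltW// (lt_le_trans x0 xy).
Qed.

Lemma powRN_double x y q : 0 < x -> 0 < y -> y <= 2 * x -> 0 <= q ->
  x `^ (- q) <= 2 `^ q * y `^ (- q).
Proof.
move=> x0 y0 yx q0.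
have -> : x `^ (- q) = 2 `^ q * (2 * x) `^ (- q).
  rewrite powRM ?(ltW x0)// mulrA -powRD; last by rewrite pnatr_eq0/= implybT.
  by rewrite subrr powRr0 mul1r.
by rewrite ler_wpM2l ?powR_ge0// le_powRN.
Qed.

(** The relation between [D] and [K] makes the two bounds comparable at radius [K]. If r <= K, then
    1 + r <= 2K turns the first bound into 4 K^(-q), and K is at least half of K + r. If r > K, then
    1 + r is at least half of K + r in the second bound. Halving costs 2^q, and 4 + 2c covers both
    regimes, so one majorant serves for all frequencies. *)
Lemma split_decay_bound q K r D c w : 0 < q -> 1 <= K -> 0 <= r -> 0 <= c ->
  D = 2 * K `^ (- (q + 1)) -> w <= (1 + r) * D -> w <= 2 * (c * (1 + r) `^ (- q)) ->
  w <= 2 `^ q * (4 + 2 * c) * (K + r) `^ (- q).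
Proof.
move=> q0 K1 r0 c0 DE wD wc.
have K0 : 0 < K by apply: lt_le_trans K1.
have Kr0 : 0 < K + r by rewrite ltr_pwDl.
have p0 : 0 <= 2 `^ q * (K + r) `^ (- q) by rewrite mulr_ge0 ?powR_ge0.
suff : w <= 4 * (2 `^ q * (K + r) `^ (- q)) \/ w <= 2 * c * (2 `^ q * (K + r) `^ (- q)).
  have e : 2 `^ q * (4 + 2 * c) * (K + r) `^ (- q) =
    4 * (2 `^ q * (K + r) `^ (- q)) + 2 * c * (2 `^ q * (K + r) `^ (- q)) by ring.
  by case=> h; apply: (le_trans h); rewrite e ?lerDl ?lerDr !mulr_ge0// ?powR_ge0.
have [rK|Kr] := leP r K.
  left; apply: (le_trans wD).
  have h := @powRN_double K (K + r) q K0 Kr0 _ (ltW q0).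
  have {}h : K `^ (- q) <= 2 `^ q * (K + r) `^ (- q) by apply: h; lra.
  apply: (@le_trans _ _ (4 * K `^ (- q))); last by rewrite ler_wpM2l.
  have KE : K `^ (- q) = K * K `^ (- (q + 1)).
    rewrite -{2}[K]powRr1 ?(ltW K0)// -powRD; last by rewrite (gt_eqF K0)/= implybT.
    by congr (_ `^ _); ring.
  rewrite DE KE; have := powR_ge0 K (- (q + 1)); move: (K `^ _) => z z0.
  have : (1 + r) * z <= (2 * K) * z by rewrite ler_wpM2r//; lra.
  lra.
right; apply: (le_trans wc); rewrite mulrA ler_wpM2l ?mulr_ge0//.
by apply: powRN_double; lra.
Qed.

End powR_estimates.

(** * The Euclidean norm against the coordinates *)

Section euclidean_norm.
Variables (R : realType) (n : nat).
Implicit Types (u x : 'rV[R]_n).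

Lemma enorm_ge0 u : 0 <= enorm u. Proof. exact: sqrtr_ge0. Qed.

Lemma norm_coord_le_enorm u i : `|u ord0 i| <= enorm u.
Proof.
rewrite -sqrtr_sqr; apply: ler_wsqrtr; rewrite /dot (bigD1 i)//= -expr2 lerDl.
by apply: sumr_ge0 => j _; rewrite -expr2 sqr_ge0.
Qed.

Lemma enormZ (c : R) u : enorm (c *: u) = `|c| * enorm u.
Proof.
rewrite /enorm -sqrtr_sqr -sqrtrM ?sqr_ge0//; congr Num.sqrt.
by rewrite /dot mulr_sumr; apply: eq_bigr => i _; rewrite !mxE expr2; ring.
Qed.

Lemma powR_enorm_le_prod (K g : R) u : (0 < n)%N -> 0 < K -> 0 < g ->
  (K + enorm u) `^ (- (n%:R + g)) <=
  \prod_(i < n) (K + `|u ord0 i|) `^ (- (g / n%:R) - 1).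
Proof.
move=> n0 K0 g0; have n0' : (n%:R : R) != 0 by rewrite pnatr_eq0 -lt0n.
have -> : - (n%:R + g) = (- (g / n%:R) - 1) * n%:R by field.
rewrite powRrM powR_mulrn ?powR_ge0//.
have -> z : z ^+ n = \prod_(i < n) z :> R by rewrite prodr_const card_ord.
apply: ler_prod => i _; rewrite powR_ge0/= -opprD; apply: le_powRN.
- by rewrite ltr_pwDl.
- by rewrite lerD2l norm_coord_le_enorm.
- by rewrite addr_ge0// divr_ge0// ltW.
Qed.

End euclidean_norm.

(** * Cosine test functions for the Fortet-Mourier distance *)

Section fortet_mourier_test.
Variables (R : realType) (n : nat).
Implicit Types (u x y : 'rV[R]_n) (mu : probability 'rV[R]_n R).

Definition cos_test u x y : R := (1 + enorm u)^-1 * cos (dot u (x - y)).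

Lemma differentiable_dot u y : differentiable (dot u) y.
Proof.
have -> : dot u = \sum_(i < n) (fun v : 'rV[R]_n => u ord0 i * v ord0 i).
  by apply/funext => v; rewrite fct_sumE.
apply: differentiable_sum => i; apply: differentiableM => //.
exact: differentiable_coord.
Qed.

Lemma is_derive_cos_affine (c a b t : R) :
  is_derive t (1:R) (fun s => c * cos (a - s * b)) (c * b * sin (a - t * b)).
Proof.
have h1 : is_derive t 1 (fun s : R => a - s * b) (- b).
  have -> : (fun s : R => a - s * b) = cst a + (- b) *: id.
    by apply/funext => s; change (a - s * b = a + (- b) * s); rewrite mulNr mulrC.
  apply: (is_derive_eq (is_deriveD (is_derive_cst a t 1) (is_deriveZ (- b) (is_derive_id t 1)))).
  by rewrite add0r /GRing.scale/= mulr1.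
have h2 := @is_derive1_comp _ cos (fun s => a - s * b) t _ _ (is_derive_cos _) h1.
apply: (is_derive_eq (is_deriveZ c h2)).
by rewrite /GRing.scale/= mulrNN mulrA mulrAC.
Qed.

Lemma differentiable_cos_test u x y : differentiable (cos_test u x) y.
Proof.
(* The factor 1 matches the slope parameter of [is_derive_cos_affine]. *)
pose k (t : R) := (1 + enorm u)^-1 * cos (dot u x - t * 1).
have -> : cos_test u x = k \o dot u.
  by apply/funext => z; rewrite /k /= mulr1 -dotBr.
apply: differentiable_comp; first exact: differentiable_dot.
apply/derivable1_diffP.
by case: (is_derive_cos_affine (1 + enorm u)^-1 (dot u x) 1 (dot u y)).
Qed.

(** Along y + s v the phase is affine in s with slope [- dot u v], so the directional derivative has
    the same difference quotient as a one-variable cosine. *)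
Lemma derive_cos_test u x y (v : 'rV[R]_n) :
  'D_v (cos_test u x) y = (1 + enorm u)^-1 * dot u v * sin (dot u (x - y)).
Proof.
have h := is_derive_cos_affine (1 + enorm u)^-1 (dot u (x - y)) (dot u v) 0.
have -> : 'D_v (cos_test u x) y =
    'D_1 (fun s : R => (1 + enorm u)^-1 * cos (dot u (x - y) - s * dot u v)) 0.
  pose G (s : R) := (1 + enorm u)^-1 * cos (dot u (x - y) - s * dot u v).
  have E : (fun h : R => h^-1 *: ((cos_test u x \o shift y) (h *: v) - cos_test u x y)) =
      (fun h : R => h^-1 *: ((G \o shift 0) (h *: (1:R)) - G 0)); last by rewrite /derive E.
  apply/funext => t; rewrite /G/=.
  rewrite /GRing.scale/= addr0 mulr1 mul0r subr0 /cos_test; congr (_ * (_ * cos _ - _)).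
  rewrite !dotBr -addrA -opprD; congr (_ - _); rewrite /dot mulr_sumr -big_split/=.
  by apply: eq_bigr => i _; rewrite !mxE; ring.
by case: h => _ ->; rewrite mul0r subr0.
Qed.

Lemma grad_cos_test u x :
  grad (cos_test u x) = fun y => ((1 + enorm u)^-1 * sin (dot u (x - y))) *: u.
Proof.
apply/funext => y; apply/rowP => i; rewrite !mxE derive_cos_test mulrAC.
congr (_ * _ * _); rewrite /dot (bigD1 i)//= !mxE !eqxx mulr1 big1 ?addr0// => j ji.
by rewrite !mxE (negbTE ji) mulr0.
Qed.

Lemma M1_cos_test u x : M1 (cos_test u x).
Proof.
have c0 : 0 < 1 + enorm u by rewrite ltr_pwDl ?enorm_ge0.
split; first split.
- exact: differentiable_cos_test.
- rewrite grad_cos_test.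
  pose k (t : R) := (1 + enorm u)^-1 * sin (dot u x - t).
  have ck : continuous k.
    move=> t; apply: cvgM; first exact: cvg_cst.
    apply: (@continuous_comp _ _ _ (fun t : R => dot u x - t) sin); last exact: continuous_sin.
    by apply: cvgB; [exact: cvg_cst|exact: cvg_id].
  move=> y.
  have -> : (fun y => ((1 + enorm u)^-1 * sin (dot u (x - y))) *: u) =
      (fun t : R => t *: u) \o (k \o dot u).
    by apply/funext => z /=; rewrite /k dotBr.
  apply: continuous_comp; last exact: scalel_continuous.
  by apply: continuous_comp; [exact: continuous_dot|exact: ck].
(* The budget 1 is spent exactly: 1/(1+|u|) bounds the function and |u|/(1+|u|) its gradient. *)
- have -> : (1%E : \bar R) = ((1 + enorm u)^-1 + (1 + enorm u)^-1 * enorm u)%:E.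
    by congr EFin; field; rewrite gt_eqF.
  rewrite EFinD; apply: leeD; apply: ge_ereal_sup => _ [y _ <-]; rewrite lee_fin.
    rewrite normrM gtr0_norm ?invr_gt0// ler_piMr ?invr_ge0 ?(ltW c0)//.
    exact: cos_norm_le1.
  rewrite /= grad_cos_test ger0_norm ?enorm_ge0// enormZ ler_wpM2r ?enorm_ge0//.
  rewrite normrM gtr0_norm ?invr_gt0// ler_piMr ?invr_ge0 ?(ltW c0)//.
  exact: sin_norm_le1.
Qed.

Lemma integral_cos_test mu u x :
  (\int[mu]_y (cos_test u x y)%:E = ((1 + enorm u)^-1 * inversion_integrand mu u x)%:E)%E.
Proof.
rewrite inversion_integrandE -RintegralZl//; last exact: integrable_cos_dot.
by rewrite RintegralE//; exact: (integrableZl measurableT _ (integrable_cos_dot mu u x)).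
Qed.

Lemma dFM_ge0 mu1 mu2 : (0 <= dFM mu1 mu2)%E.
Proof.
apply: (@le_trans _ _ (`|\int[mu1]_y (cos_test 0 0 y)%:E - \int[mu2]_y (cos_test 0 0 y)%:E|)%E).
  exact: abse_ge0.
by apply: ereal_sup_ubound; exists (cos_test 0 0) => //; exact: M1_cos_test.
Qed.

Lemma M1_norm_le1 (f : 'rV[R]_n -> R) y : M1 f -> `|f y| <= 1.
Proof.
move=> [_ h]; rewrite -lee_fin; apply: le_trans h.
apply: (@le_trans _ _ (supnorm f)).
  by apply: ereal_sup_ubound; exists y.
(* The gradient supremum is nonnegative, being at least the norm of the gradient at 0. *)
rewrite -[leLHS]adde0; apply: leeD2l.
apply: (@le_trans _ _ (`|(@enorm R n \o grad f) 0|)%:E); first by rewrite lee_fin.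
by apply: ereal_sup_ubound; exists 0.
Qed.

Lemma integral_le1 mu (f : 'rV[R]_n -> R) : measurable_fun setT f ->
  (forall y, `|f y| <= 1) -> (`|\int[mu]_y (f y)%:E| <= 1)%E.
Proof.
move=> mf f1; have fi := @bounded_integrable _ _ _ mu setT f 1 measurableT mf (fun y _ => f1 y).
apply: (le_trans (le_abse_integral _ _ _)) => //; first exact/measurable_EFinP.
apply: (@le_trans _ _ (\int[mu]_y (cst 1 y)%:E)%E).
  apply: ge0_le_integral => //.
  - by apply/measurable_EFinP; apply: measurableT_comp.
  - exact/measurable_EFinP.
  - by move=> y _; rewrite lee_fin.
rewrite (_ : (fun y => (cst 1 y)%:E) = cst 1%E)// integral_cst// mul1e.
exact: (@probability_le1 _ _ _ mu setT measurableT).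
Qed.

(** Finiteness lets the distance be handled as a real number, and the value 2 is what later forces
    the switching radius to be at least 1. *)
Lemma dFM_le2 mu1 mu2 : (dFM mu1 mu2 <= 2%:E)%E.
Proof.
apply: ge_ereal_sup => _ [f Mf <-].
have mf : measurable_fun setT f.
  by apply: continuous_measurable_rV => y; apply: differentiable_continuous; exact: Mf.1.1.
have f1 y := @M1_norm_le1 f y Mf.
apply: (le_trans (lee_abs_sub _ _)).
have -> : (2%:E = 1 + 1 :> \bar R)%E by rewrite -EFinD.
by apply: leeD; exact: integral_le1.
Qed.

Lemma dFM_fin_num mu1 mu2 : dFM mu1 mu2 \is a fin_num.
Proof.
rewrite ge0_fin_numE ?dFM_ge0//; apply: le_lt_trans (dFM_le2 _ _) _.
exact: ltry.
Qed.

Lemma inversion_integrandB_le_dFM mu1 mu2 u x :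
  `|inversion_integrand mu1 u x - inversion_integrand mu2 u x| <=
  (1 + enorm u) * fine (dFM mu1 mu2).
Proof.
have c0 : 0 < 1 + enorm u by rewrite ltr_pwDl ?enorm_ge0.
rewrite mulrC -ler_pdivrMr// -lee_fin fineK ?dFM_fin_num//.
apply: ereal_sup_ubound; exists (cos_test u x); first exact: M1_cos_test.
rewrite !integral_cos_test -EFinB/= -mulrBr normrM gtr0_norm ?invr_gt0//.
by rewrite mulrC.
Qed.

End fortet_mourier_test.

(** * The supremum bound for the densities *)

Section density_difference.
Variables (R : realType) (n : nat) (g c : R).
Hypotheses (n0 : (0 < n)%N) (g0 : 0 < g) (c0 : 0 < c).
Implicit Types (u x y : 'rV[R]_n) (mu : probability 'rV[R]_n R).
Local Notation lam := (lebesgue_rV R n).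
Local Notation psi := inversion_integrand.

(** The decay hypothesis phrased for the law alone; the left-hand side is the modulus of its
    characteristic function. *)
Definition charfun_decay mu := forall u,
  Num.sqrt (cos_mean mu u ^+ 2 + sin_mean mu u ^+ 2) <= c * (1 + enorm u) `^ (- (n%:R + g)).

Definition decay_majorant K u : R :=
  \prod_(i < n) (K + `|u ord0 i|) `^ (- (g / n%:R) - 1).

Let n0R : 0 < n%:R :> R. Proof. by rewrite ltr0n. Qed.

Let al0 : 0 < g / n%:R. Proof. by rewrite divr_gt0. Qed.

Lemma integrable_decay_majorant (b K : R) : 0 < K ->
  lam.-integrable setT (EFin \o (fun u => b * decay_majorant K u)).
Proof.
move=> K0; apply: (integrableZl measurableT b (f := EFin \o decay_majorant K)).
apply/integrableP; split.
  apply/measurable_EFinP; apply: measurable_prodT => i.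
  apply: measurableT_comp (measurable_powR _) _; apply: measurable_funD => //.
  by apply: measurableT_comp => //; exact: measurable_coord.
under eq_integral => u _.
  rewrite /= ger0_norm; last by apply: prodr_ge0 => i _; exact: powR_ge0.
  over.
by rewrite integral_prod_powR_tail// ltry.
Qed.

Lemma Rintegral_decay_majorant (b K : R) : 0 < K ->
  \int[lam]_u (b * decay_majorant K u) = b * ((2 * n%:R / g) ^+ n * K `^ (- g)).
Proof.
move=> K0; rewrite RintegralZl//; last first.
  have := integrable_decay_majorant 1 K0; apply: eq_integrable => // u _ /=.
  by rewrite mul1r.
congr (_ * _); rewrite /Rintegral integral_prod_powR_tail//=.
have gn0 : g != 0 by rewrite gt_eqF.
have nn0 : (n%:R : R) != 0 by rewrite gt_eqF.
have -> : K `^ (- g) = (K `^ (- (g / n%:R))) ^+ n.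
  by rewrite -powR_mulrn ?powR_ge0// -powRrM; congr (_ `^ _); field.
rewrite -exprMn; congr (_ ^+ _).
by move: (K `^ _) => z; field; rewrite gn0 nn0.
Qed.

Lemma norm_integrand_le_majorant mu u x : charfun_decay mu ->
  `|psi mu u x| <= c * decay_majorant 1 u.
Proof.
move=> h; apply: (le_trans (norm_inversion_integrand_le mu u x)).
apply: (le_trans (h u)); rewrite ler_wpM2l ?(ltW c0)//.
exact: powR_enorm_le_prod.
Qed.

(** The three factors come from Fourier inversion, from the two-regime bound with q = n + g, and
    from the integral of the product majorant. *)
Definition density_constant : R :=
  (2 * pi) ^- n * (2 `^ (n%:R + g) * (4 + 2 * c)) * (2 * n%:R / g) ^+ n.

Lemma density_constant_gt0 : 0 < density_constant.
Proof.
have c4 : 0 < 4 + 2 * c by rewrite addr_gt0// mulr_gt0.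
by rewrite /density_constant !(mulr_gt0, powR_gt0, invr_gt0, exprn_gt0, pi_gt0).
Qed.

Variables mu1 mu2 : probability 'rV[R]_n R.
Hypotheses (h1 : charfun_decay mu1) (h2 : charfun_decay mu2).
Local Notation f1 := (inversion_density mu1).
Local Notation f2 := (inversion_density mu2).

Lemma inversion_densityB_le x :
  `|f1 x - f2 x| <=
  density_constant * fine (dFM mu1 mu2) `^ (g / (n%:R + 1 + g)).
Proof.
set D := fine _.
have D0 : 0 <= D by apply: fine_ge0; exact: dFM_ge0.
have D2 : D <= 2 by rewrite -lee_fin fineK ?dFM_fin_num// dFM_le2.
have iB := integrable_decay_majorant c (@ltr01 R).
have ip mu : charfun_decay mu -> lam.-integrable setT (EFin \o (psi mu ^~ x)).
  move=> h; apply: (integrable_inversion_integrand _ iB) => u y.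
  exact: norm_integrand_le_majorant.
have pD u := inversion_integrandB_le_dFM mu1 mu2 u x.
rewrite /inversion_density -mulrBr -RintegralB//; [|exact: ip|exact: ip].
have C0 : 0 <= (2 * pi : R) ^- n by rewrite invr_ge0 exprn_ge0// mulr_ge0// pi_ge0.
have idiff : lam.-integrable setT (EFin \o (fun u => psi mu1 u x - psi mu2 u x)).
  have := integrableB measurableT (ip _ h1) (ip _ h2).
  by apply: eq_integrable => // u _ /=; rewrite EFinB.
rewrite normrM ger0_norm// /density_constant -!mulrA ler_wpM2l//.
apply: (le_trans (le_normr_Rintegral _ _)) => //.
(* At distance 0 the switching radius would be infinite; the two integrands then coincide and both
   sides vanish. *)
have [D00|Dn0] := eqVneq D 0.
  have -> : \int[lam]_u `|psi mu1 u x - psi mu2 u x| = \int[lam]_u (0 : R).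
    apply: eq_Rintegral => u _; apply/eqP; rewrite eq_le normr_ge0 andbT.
    by apply: (le_trans (pD u)); rewrite -/D D00 mulr0.
  rewrite Rintegral_cst// mul0r D00 powR0 ?mulr0//.
  by rewrite gt_eqF// divr_gt0// addr_gt0// addr_gt0.
have Dp : 0 < D by rewrite lt_neqAle eq_sym Dn0.
have p0 : 0 < n%:R + 1 + g by rewrite addr_gt0// addr_gt0.
(* The solution of D = 2 K^(-(n+1+g)), the relation required by [split_decay_bound]; it is at least
   1 because D <= 2. *)
pose K := (D / 2) `^ (- (n%:R + 1 + g)^-1).
have D20 : 0 < D / 2 by rewrite divr_gt0.
have K0 : 0 < K by rewrite powR_gt0.
have K1 : 1 <= K.
  rewrite /K powRN invf_ge1 ?powR_gt0//.
  apply: (@le_trans _ _ (1 `^ (n%:R + 1 + g)^-1)); last by rewrite powR1.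
  apply: ge0_ler_powR.
  - by rewrite invr_ge0 ltW.
  - by rewrite nnegrE ltW.
  - by rewrite nnegrE.
  - by rewrite ler_pdivrMr// mul1r.
have DK : D = 2 * K `^ (- (n%:R + g + 1)).
  rewrite /K -powRrM mulrNN [n%:R + g + 1]addrAC mulVf ?gt_eqF// powRr1 ?(ltW D20)//.
  by rewrite mulrC divfK.
have Kg : K `^ (- g) <= D `^ (g / (n%:R + 1 + g)).
  rewrite /K -powRrM mulrNN [_^-1 * g]mulrC; apply: ge0_ler_powR.
  - by rewrite divr_ge0// ltW.
  - by rewrite nnegrE ltW.
  - by rewrite nnegrE.
  - by rewrite ler_pdivrMr// ler_peMr// ler1n.
apply: (@le_trans _ _ (\int[lam]_u (2 `^ (n%:R + g) * (4 + 2 * c) * decay_majorant K u))).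
  apply: le_Rintegral => //; first exact: integrable_norm idiff.
    exact: integrable_decay_majorant.
  move=> u _; apply: (@le_trans _ _ (2 `^ (n%:R + g) * (4 + 2 * c) *
      (K + enorm u) `^ (- (n%:R + g)))).
    apply: (split_decay_bound _ K1 (enorm_ge0 u) (ltW c0) DK (pD u)); first by rewrite addr_gt0.
    rewrite mulr2n mulrDl mul1r; apply: (le_trans (ler_normB _ _)); apply: lerD.
      by apply: le_trans (h1 u); exact: norm_inversion_integrand_le.
    by apply: le_trans (h2 u); exact: norm_inversion_integrand_le.
  rewrite ler_wpM2l//; last exact: powR_enorm_le_prod.
  by rewrite mulr_ge0 ?powR_ge0// addr_ge0// mulr_ge0// ltW.
rewrite Rintegral_decay_majorant// !mulrA ler_wpM2l// mulr_ge0//.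
  by rewrite mulr_ge0 ?powR_ge0// addr_ge0// mulr_ge0// ltW.
by rewrite exprn_ge0// divr_ge0// ?mulr_ge0// ltW.
Qed.

Lemma is_density_of_decay mu : charfun_decay mu ->
  is_density mu (inversion_density mu) /\ continuous (inversion_density mu).
Proof.
move=> h; have iB := integrable_decay_majorant c (@ltr01 R).
have hB u x := norm_integrand_le_majorant u x h.
split; first exact: (is_density_inversion hB iB).
exact: (continuous_inversion_density hB iB).
Qed.

End density_difference.

(** * From the supremum bound to total variation *)

Section total_variation.
Variables (R : realType) (n : nat) (delta cf S : R).
Hypotheses (delta0 : 0 < delta) (S0 : 0 < S).
Implicit Types (mu : probability 'rV[R]_n R) (f h : 'rV[R]_n -> R).
Local Notation lam := (lebesgue_rV R n).

Lemma measurable_enorm : measurable_fun setT (@enorm R n).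
Proof.
apply: (measurableT_comp (f := @Num.sqrt R)).
  by apply: continuous_measurable_fun; exact: sqrt_continuous.
exact: measurable_dot.
Qed.

Lemma is_density_le_add mu1 mu2 f1 f2 (A : set 'rV[R]_n) :
  is_density mu1 f1 -> is_density mu2 f2 -> (forall x, f1 x <= f2 x + S) ->
  measurable A -> (mu1 A <= mu2 A + S%:E * lam A)%E.
Proof.
move=> [mf1 f10 d1] [mf2 f20 d2] f12 mA; rewrite d1// d2//.
have mf D f : measurable_fun setT f -> measurable_fun D (EFin \o f : 'rV[R]_n -> \bar R).
  by move=> mf; exact/measurable_EFinP/measurable_funTS.
rewrite -integral_cst// -ge0_integralD//;
  do ?[exact: mf | by move=> x _; rewrite lee_fin | by move=> x _; rewrite lee_fin ltW].
apply: ge0_le_integral => //.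
- by move=> x _; rewrite lee_fin.
- exact: mf.
- by apply: emeasurable_funD; [exact: mf|exact: measurable_cst].
- by move=> x _; rewrite -EFinD lee_fin.
Qed.

(** A point of norm below [M] has all its coordinates in ]-M, M[, so off the box the norm is at
    least [M] and Markov's inequality applies. *)
Lemma markov_box mu (M : R) : 0 < M -> (\int[mu]_x (enorm x `^ delta)%:E <= cf%:E)%E ->
  (mu (~` rV_box (const_mx (- M)%R : 'rV[R]_n) (const_mx M)) <= (cf * M `^ (- delta))%:E)%E.
Proof.
move=> M0 hc; set Q := rV_box _ _.
have mQ : measurable (~` Q) by apply: measurableC; exact: measurable_rV_box.
have p0 : 0 < M `^ delta by rewrite powR_gt0.
have me : measurable_fun setT (fun x : 'rV[R]_n => (enorm x `^ delta)%:E).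
  by apply/measurable_EFinP/(measurableT_comp (measurable_powR _)); exact: measurable_enorm.
rewrite powRN EFinM lee_pdivlMr//; apply: le_trans hc.
rewrite muleC -integral_cst//.
apply: (@le_trans _ _ (\int[mu]_(x in ~` Q) (enorm x `^ delta)%:E)%E).
  apply: ge0_le_integral => //.
  - by move=> x _; rewrite lee_fin ltW.
  - exact: measurable_funTS.
  move=> x Qx; rewrite lee_fin; apply: ge0_ler_powR;
    rewrite ?nnegrE ?enorm_ge0 ?(ltW M0) ?(ltW delta0)//.
  rewrite leNgt; apply/negP => xM; apply: Qx => i; rewrite !mxE.
  have := le_lt_trans (norm_coord_le_enorm x i) xM.
  by rewrite ltr_norml => /andP[-> /ltW ->].
apply: ge0_subset_integral => // x _.
by rewrite lee_fin powR_ge0.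
Qed.

(** The estimate is one-sided, so only the tail of [mu1] has to be controlled: with [k] = 1 + h in
    [0, 2], the integral of [k] over the box against [mu2] is at most its integral over the whole
    space. The factor 2 in both constants is the bound on [k]. *)
Lemma integralB_le_density mu1 mu2 f1 f2 h :
  is_density mu1 f1 -> is_density mu2 f2 -> (forall x, f1 x <= f2 x + S) ->
  (\int[mu1]_x (enorm x `^ delta)%:E <= cf%:E)%E ->
  measurable_fun setT h -> (forall x, `|h x| <= 1) ->
  \int[mu1]_x h x - \int[mu2]_x h x <=
    (2 ^+ n.+1 + 2 * cf) * S `^ (delta / (n%:R + delta)).
Proof.
move=> d1 d2 f12 hc mh h1.
have nd0 : 0 < n%:R + delta by rewrite ltr_wpDl.
(* This half-width balances the two errors: S M^n and M^(-delta) both equal S^(delta/(n+delta)). *)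
pose M := S `^ (- (n%:R + delta)^-1).
have M0 : 0 < M by rewrite powR_gt0.
pose Q := rV_box (const_mx (- M) : 'rV[R]_n) (const_mx M).
have mQ : measurable Q by exact: measurable_rV_box.
have lamQ : lam Q = ((2 * M) ^+ n)%:E.
  apply: (etrans (lebesgue_rV_box _)) => [i|]; first by rewrite !mxE; lra.
  rewrite (eq_bigr (fun=> 2 * M)) => [|i _]; last by rewrite !mxE opprK mulr2n mulrDl mul1r.
  by rewrite prodr_const card_ord.
pose k x := 1 + h x.
have k0 x : 0 <= k x by have := h1 x; rewrite ler_norml /k => /andP[]; lra.
have k2 x : k x <= 2 by have := h1 x; rewrite ler_norml /k => /andP[]; lra.
have mk : measurable_fun setT k by exact: measurable_funD.
have mkE : measurable_fun setT (EFin \o k) by exact/measurable_EFinP.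
have ik mu D : measurable D -> mu.-integrable D (EFin \o k).
  move=> mD; apply: (@bounded_integrable _ _ _ _ _ _ 2) => //; first exact: measurable_funTS.
  by move=> x _; rewrite ger0_norm.
have E mu : \int[mu]_x h x = \int[mu]_x k x - 1.
  rewrite /k RintegralD//.
  - by rewrite Rintegral_cst// (congr1 fine (@probability_setT _ _ _ mu)) mulr1 addrC addKr.
  - exact: finite_measure_integrable_cst.
  - exact: (@bounded_integrable _ _ _ _ _ _ 1).
have inQ : (\int[mu1]_(x in Q) (k x)%:E <=
    \int[mu2]_x (k x)%:E + (S * (2 * (2 * M) ^+ n))%:E)%E.
  (* The pointwise density bound becomes the inequality mu1 <= mu2 + S lam between measures, which
     passes to integrals of nonnegative functions. *)
  pose m2 := measure_add mu2 (mscale (NngNum (ltW S0)) lam).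
  apply: (@le_trans _ _ (\int[m2]_(x in Q) (k x)%:E)%E).
    apply: ge0_le_measure_integral => // A mA.
    suff : (mu1 A <= mu2 A + mscale (NngNum (ltW S0)) lam A)%E by rewrite -measure_addE.
    exact: (is_density_le_add d1 d2 f12 mA).
  rewrite ge0_integral_measure_add//;
    do ?[exact: measurable_funTS | by move=> x _; rewrite lee_fin].
  rewrite ge0_integral_mscale//;
    do ?[exact: measurable_funTS | by move=> x _; rewrite lee_fin].
  apply: leeD.
    by apply: ge0_subset_integral => // x _; rewrite lee_fin.
  rewrite EFinM; apply: lee_wpmul2l; first by rewrite lee_fin ltW.
  apply: (@le_trans _ _ (\int[lam]_(x in Q) (cst 2%:E x))%E).
    apply: ge0_le_integral => //.
    - by move=> x _; rewrite lee_fin.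
    - exact: measurable_funTS.
    - by move=> x _; rewrite lee_fin.
  rewrite integral_cst// EFinM; apply: lee_wpmul2l => //.
  by rewrite -lamQ; exact: lexx.
have outQ : (\int[mu1]_(x in ~` Q) (k x)%:E <= (2 * (cf * M `^ (- delta)))%:E)%E.
  apply: (@le_trans _ _ (\int[mu1]_(x in ~` Q) (cst 2%:E x))%E).
    apply: ge0_le_integral => //.
    - exact: measurableC.
    - by move=> x _; rewrite lee_fin.
    - exact: measurable_funTS.
    - by move=> x _; rewrite lee_fin.
  rewrite integral_cst//; last exact: measurableC.
  rewrite EFinM; apply: lee_wpmul2l => //.
  exact: markov_box.
have tot : \int[mu1]_x k x <=
    \int[mu2]_x k x + S * (2 * (2 * M) ^+ n) + 2 * (cf * M `^ (- delta)).
  rewrite -lee_fin !EFinD !RintegralE//; [|exact: ik|exact: ik].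
  rewrite -{1}(setUv Q) ge0_integral_setU//; last 4 first.
  - exact: measurableC.
  - by rewrite setUv.
  - by move=> x _; rewrite lee_fin.
  - exact/disj_setPCl.
  exact: leeD.
have SM : S * M ^+ n = S `^ (delta / (n%:R + delta)).
  rewrite -powR_mulrn ?(ltW M0)// /M -powRrM -{1}[S]powRr1 ?(ltW S0)// -powRD; last first.
    by rewrite (gt_eqF S0)/= implybT.
  by congr (_ `^ _); field; rewrite gt_eqF.
have Md : M `^ (- delta) = S `^ (delta / (n%:R + delta)).
  by rewrite /M -powRrM mulrNN mulrC.
rewrite !E opprB addrA subrK lerBlDl; apply: (le_trans tot).
rewrite -addrA lerD2l Md exprMn -SM exprS.
by rewrite le_eqVlt; apply/orP; left; apply/eqP; move: (M ^+ n) (2 ^+ n) => a b; ring.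
Qed.

End total_variation.
Section total_variation_distance.
Variables (R : realType) (n : nat) (delta cf S : R).
Hypotheses (delta0 : 0 < delta) (cf0 : 0 < cf).
Variables mu1 mu2 : probability 'rV[R]_n R.
Variables f1 f2 : 'rV[R]_n -> R.
Hypotheses (d1 : is_density mu1 f1) (d2 : is_density mu2 f2).
Hypothesis f12 : forall x, `|f1 x - f2 x| <= S.
Hypothesis mom1 : (\int[mu1]_x (enorm x `^ delta)%:E <= cf%:E)%E.
Hypothesis mom2 : (\int[mu2]_x (enorm x `^ delta)%:E <= cf%:E)%E.

Lemma dTV_le_density :
  (dTV mu1 mu2 <= ((2 ^+ n.+1 + 2 * cf) * S `^ (delta / (n%:R + delta)))%:E)%E.
Proof.
apply: ge_ereal_sup => _ [h [mh h1] <-].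
have ih (mu : probability 'rV[R]_n R) : mu.-integrable setT (EFin \o h).
  exact: (@bounded_integrable _ _ _ _ _ _ 1).
have S0 : 0 <= S by apply: le_trans (f12 0).
rewrite -(RintegralE measurableT (ih mu1)) -(RintegralE measurableT (ih mu2)).
rewrite -EFinB abse_EFin lee_fin.
have C0 : 0 <= (2 ^+ n.+1 + 2 * cf) * S `^ (delta / (n%:R + delta)).
  by rewrite mulr_ge0 ?powR_ge0// addr_ge0 ?exprn_ge0// mulr_ge0// ltW.
(* For S = 0 no finite half-width is optimal, but the densities coincide and hence so do the
   laws. *)
have [S00|Sn0] := eqVneq S 0.
  have -> : \int[mu1]_x h x = \int[mu2]_x h x; last by rewrite subrr normr0.
  rewrite /Rintegral; congr fine; apply: eq_measure_integral => A mA _.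
  have [_ _ e1] := d1; have [_ _ e2] := d2.
  apply: (etrans (e1 A mA)); apply: (etrans _ (esym (e2 A mA))).
  by apply: eq_integral => x _; have := f12 x; rewrite S00 normr_le0 subr_eq0 => /eqP ->.
have Sp : 0 < S by rewrite lt_neqAle eq_sym Sn0.
have le12 x : f1 x <= f2 x + S.
  by have := f12 x; rewrite ler_norml => /andP[_]; lra.
have le21 x : f2 x <= f1 x + S.
  by have := f12 x; rewrite ler_norml => /andP[]; lra.
rewrite ler_norml lerNl opprB; apply/andP; split.
  exact: (integralB_le_density delta0 Sp d2 d1 le21 mom2 mh h1).
exact: (integralB_le_density delta0 Sp d1 d2 le12 mom1 mh h1).
Qed.

End total_variation_distance.

(** * Passage from random vectors to their laws, and conclusion *)

Section random_vectors.
Context d (T : measurableType d) (R : realType) (n : nat).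
Variables (P : probability T R) (X : {RV P >-> 'rV[R]_n}).

Lemma norm_charfun u : `|charfun P X u| =
  (Num.sqrt (cos_mean (distribution P X) u ^+ 2 + sin_mean (distribution P X) u ^+ 2))%:C.
Proof.
rewrite normc_def /charfun /cexpectation /=.
have mX : measurable_fun setT X by [].
have E (k : R -> R) : (forall t, `|k t| <= 1) -> continuous k ->
    \int[distribution P X]_y k (dot u y) = \int[P]_w k (dot u (X w)).
  move=> k1 ck; have mk : measurable_fun setT (fun y : 'rV[R]_n => k (dot u y)).
    apply: continuous_measurable_rV => y.
    by apply: continuous_comp; [exact: continuous_dot|exact: ck].
  rewrite /Rintegral integral_distribution//; first exact/measurable_EFinP.
  apply: (@bounded_integrable _ _ _ _ _ (fun w => k (dot u (X w))) 1) => //.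
  exact: (measurableT_comp mk mX).
rewrite /cos_mean /sin_mean !E//.
- exact: sin_norm_le1.
- exact: continuous_sin.
- exact: cos_norm_le1.
- exact: continuous_cos.
Qed.

Lemma expectation_enorm_powR (delta : R) :
  ('E_P[fun w => (enorm (X w) `^ delta)%R])%E =
  (\int[distribution P X]_x (enorm x `^ delta)%:E)%E.
Proof.
rewrite unlock ge0_integral_distribution//.
- by apply/measurable_EFinP/(measurableT_comp (measurable_powR _)); exact: measurable_enorm.
- by move=> x; rewrite lee_fin powR_ge0.
Qed.

End random_vectors.

Theorem lemma2p2 (R : realType) (d : nat) (gamma cphi : R) :
  (1 <= d)%N -> 0 < gamma -> 0 < cphi ->
  exists Gbar : R, 0 < Gbar /\
  forall delta cf : R, 0 < delta -> 0 < cf ->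
  exists G : R, 0 < G /\
  forall (d1 d2 : measure_display)
    (T1 : measurableType d1) (T2 : measurableType d2)
    (P1 : probability T1 R) (P2 : probability T2 R)
    (X1 : {RV P1 >-> 'rV[R]_d}) (X2 : {RV P2 >-> 'rV[R]_d}),
  (forall u : 'rV[R]_d,
     `|charfun P1 X1 u| <= (cphi * (1 + enorm u) `^ (- d%:R - gamma))%:C) ->
  (forall u : 'rV[R]_d,
     `|charfun P2 X2 u| <= (cphi * (1 + enorm u) `^ (- d%:R - gamma))%:C) ->
  ('E_P1[fun w => (enorm (X1 w) `^ delta)%R] <= cf%:E)%E ->
  ('E_P2[fun w => (enorm (X2 w) `^ delta)%R] <= cf%:E)%E ->
  let mu1 := distribution P1 X1 in
  let mu2 := distribution P2 X2 in
  (dTV mu1 mu2 <= G%:E *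
     dFM mu1 mu2 `^ (gamma * delta / ((d%:R + 1 + gamma) * (d%:R + delta))))%E
  /\ exists f1 f2 : 'rV[R]_d -> R,
     [/\ is_density mu1 f1, is_density mu2 f2, continuous f1, continuous f2 &
         (supnorm (fun x => (f1 x - f2 x)%R) <=
            Gbar%:E * dFM mu1 mu2 `^ (gamma / (d%:R + 1 + gamma)))%E].
Proof.
move=> d0 g0 c0; exists (density_constant d gamma cphi).
have G0 : 0 < density_constant d gamma cphi by exact: density_constant_gt0.
split => // delta cf delta0 cf0.
(* Inserting the supremum bound into the total variation estimate raises [density_constant] to the
   power delta/(d+delta) and multiplies the two exponents, which gives g. *)
exists ((2 ^+ d.+1 + 2 * cf) * density_constant d gamma cphi `^ (delta / (d%:R + delta))).
split; first by rewrite mulr_gt0 ?powR_gt0// addr_gt0 ?exprn_gt0// mulr_gt0.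
move=> d1 d2 T1 T2 P1 P2 X1 X2 h1 h2 m1 m2 mu1 mu2.
have decay1 : charfun_decay gamma cphi mu1.
  by move=> u; have := h1 u; rewrite norm_charfun lecR -opprD.
have decay2 : charfun_decay gamma cphi mu2.
  by move=> u; have := h2 u; rewrite norm_charfun lecR -opprD.
rewrite expectation_enorm_powR in m1; rewrite expectation_enorm_powR in m2.
have [den1 cont1] := is_density_of_decay d0 g0 c0 decay1.
have [den2 cont2] := is_density_of_decay d0 g0 c0 decay2.
have diff := inversion_densityB_le d0 g0 c0 decay1 decay2.
have -> : dFM mu1 mu2 = (fine (dFM mu1 mu2))%:E by rewrite fineK// dFM_fin_num.
have D0 : 0 <= fine (dFM mu1 mu2) by apply: fine_ge0; exact: dFM_ge0.
rewrite !poweR_EFin; split; last first.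
  exists (inversion_density mu1), (inversion_density mu2).
  split; [exact: den1|exact: den2|exact: cont1|exact: cont2|].
  by apply: ge_ereal_sup => _ [x _ <-]; rewrite -EFinM lee_fin.
apply: (le_trans (dTV_le_density delta0 cf0 den1 den2 diff m1 m2)).
rewrite -EFinM lee_fin powRM ?powR_ge0 ?(ltW G0)// mulrA -powRrM mulrACA invfM.
exact: lexx.
Qed.
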